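(* Let $\alpha:\Gamma^{+}\to\operatorname{Aut}(A)$ be an action by automorphisms on a $C^*$-algebra $A$ of the positive cone $\Gamma^{+}$ of a totally ordered abelian group $\Gamma$, and let $\gamma$ be the action of $\Gamma^+$ on $B_{\Gamma^+}\otimes A$ by the endomorphisms $\gamma_x=\tau_x\otimes\alpha_x^{-1}$. Then the partial-isometric crossed product $A\times_{\alpha}^{\mathrm{piso}}\Gamma^{+}$ is isomorphic to the isometric crossed product $((B_{\Gamma^{+}}\otimes A)\times_{\gamma}^{\mathrm{iso}}\Gamma^{+},j)$. More precisely, the $C^*$-algebra $(B_{\Gamma^{+}}\otimes A)\times_{\gamma}^{\mathrm{iso}}\Gamma^{+}$ together with the pair of homomorphisms $(k_{A},k_{\Gamma^{+}}):(A,\Gamma^{+},\alpha)\to M((B_{\Gamma^{+}}\otimes A)\times_{\gamma}^{\mathrm{iso}}\Gamma^{+})$ defined by $$k_{A}(a)=j_{B_{\Gamma^{+}}\otimes A}(1\otimes a)\quad\text{and}\quad k_{\Gamma^{+}}(x)=j_{\Gamma^{+}}(x)^{*}$$ is a partial-isometric crossed product for $(A,\Gamma^{+},\alpha)$.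
   Context: $\Gamma$ is regarded as discrete, $\Gamma^{+}=\{x\in\Gamma:x\ge 0\}$; actions of $\Gamma^+$ are semigroup homomorphisms into endomorphisms with $0$ acting as the identity. $A$ need not be unital. $B_{\Gamma^{+}}:=\overline{\operatorname{span}}\{1_s\in\ell^\infty(\Gamma^+):s\in\Gamma^+\}$, where $1_s(x)=1$ if $x\ge s$ and $0$ if $x<s$; it is a unital commutative $C^*$-algebra with unit $1=1_0$. The action $\tau:\Gamma^+\to\operatorname{End}(B_{\Gamma^+})$ is translation, $\tau_t(1_s)=1_{s+t}$. For a system $(C,\Gamma^+,\beta)$ by extendible endomorphisms (each $\beta_x$ extends to a strictly continuous endomorphism of $M(C)$): a covariant isometric representation is a pair $(\pi,V)$ with $\pi$ a non-degenerate representation of $C$, each $V_s$ an isometry, $V_sV_t=V_{s+t}$, and $\pi(\beta_s(c))=V_s\pi(c)V_s^*$. The isometric crossed product $(C\times_\beta^{\mathrm{iso}}\Gamma^+,j_C,j_{\Gamma^+})$ is the $C^*$-algebra generated by a universal covariant isometric representation $j=(j_C,j_{\Gamma^+})$ (closed span of $j_{\Gamma^+}(s)^*j_C(c)j_{\Gamma^+}(t)$): covariant isometric representations correspond bijectively to its non-degenerate representations. A partial-isometric representation of $\Gamma^{+}$ is a map $V$ such that each $V_s$ is a partial isometry and $V_sV_t=V_{s+t}$. A covariant partial-isometric representation of $(A,\Gamma^{+},\alpha)$ on a Hilbert space $H$ (or in a $C^*$-algebra $B$, with $V$ taking values in $M(B)$) is a pair $(\pi,V)$ with $\pi$ a non-degenerate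 representation of $A$ and $V$ a partial-isometric representation such that $\pi(\alpha_s(a))=V_s\pi(a)V_s^*$ and $V_s^*V_s\pi(a)=\pi(a)V_s^*V_s$. A partial-isometric crossed product of $(A,\Gamma^+,\alpha)$ is a triple $(B,i_A,i_{\Gamma^+})$ consisting of a $C^*$-algebra $B$, a non-degenerate homomorphism $i_A:A\to B$ and a partial-isometric representation $i_{\Gamma^+}:\Gamma^+\to M(B)$ such that: (i) $(i_A,i_{\Gamma^+})$ is a covariant partial-isometric representation in $B$; (ii) for every covariant partial-isometric representation $(\pi,V)$ on a Hilbert space $H$ there is a non-degenerate representation $\pi\times V$ of $B$ on $H$ with $(\pi\times V)\circ i_A=\pi$ and $\overline{(\pi\times V)}\circ i_{\Gamma^+}=V$; (iii) $B=\overline{\operatorname{span}}\{i_{\Gamma^+}(s)^*i_A(a)i_{\Gamma^+}(t)\}$. It exists, is unique up to isomorphism, and is denoted $A\times_\alpha^{\mathrm{piso}}\Gamma^+$. *)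

(* Defs.v *)
From HB Require Import structures.
From mathcomp Require Import all_boot all_order all_algebra.
From mathcomp Require Import complex.
From mathcomp Require Import mathcomp_extra boolp classical_sets functions reals.
From mathcomp Require Import topology normedtype.
From mathcomp Require Import lra.

Set Implicit Arguments.
Unset Strict Implicit.
Unset Printing Implicit Defensive.

Import Order.TTheory GRing.Theory Num.Theory.
Import numFieldNormedType.Exports.

Local Open Scope classical_set_scope.
Local Open Scope ring_scope.

(* A totally ordered abelian group; porderZmodType alone does not relate the
   order to the addition. *)
Record orderedGroup := OrderedGroup {
  og_sort :> porderZmodType;
  og_total : total (<=%R : rel og_sort);
  og_lerD : forall x y z : og_sort, x <= y -> z + x <= z + y
}.

Section PositiveCone.
Variable G : orderedGroup.

Record posCone : predArgType := PosCone { pos_val :> G; _ : 0 <= pos_val }.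

HB.instance Definition _ := [isSub for pos_val].
HB.instance Definition _ := [Choice of posCone by <:].

Implicit Types s t u : posCone.

Fact pos_add_subproof s t : 0 <= pos_val s + pos_val t.
Proof.
case: s t => [s s0] [t t0] /=; apply: (le_trans s0).
by rewrite -{1}[s]addr0; apply: og_lerD.
Qed.

Definition pos_zero := PosCone (lexx (0 : G)).
Definition pos_add s t := PosCone (pos_add_subproof s t).

Fact pos_addA : associative pos_add.
Proof. by move=> s t u; apply/val_inj; rewrite /= addrA. Qed.

Fact pos_addC : commutative pos_add.
Proof. by move=> s t; apply/val_inj; rewrite /= addrC. Qed.

Fact pos_add0 : left_id pos_zero pos_add.
Proof. by move=> s; apply/val_inj; rewrite /= add0r. Qed.

HB.instance Definition _ :=
  GRing.isNmodule.Build posCone pos_addA pos_addC pos_add0.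

End PositiveCone.
(* C*-algebras need not be unital, hence the bare multiplication cmul. *)
HB.mixin Record isCStarAlgebra (R : realType) A of CompleteNormedModule R[i] A := {
  cmul : A -> A -> A;
  cstar : A -> A;
  cmulA : associative cmul;
  cmulPl : forall (k : R[i]) a b c, cmul (k *: a + b) c = k *: cmul a c + cmul b c;
  cmulPr : forall (k : R[i]) a b c, cmul a (k *: b + c) = k *: cmul a b + cmul a c;
  cstarP : forall (k : R[i]) a b, cstar (k *: a + b) = k^* *: cstar a + cstar b;
  cstarK : involutive cstar;
  cstarM : forall a b, cstar (cmul a b) = cmul (cstar b) (cstar a);
  ler_norm_cmul : forall a b, `|cmul a b| <= `|a| * `|b|;
  cstar_identity : forall a, `|cmul (cstar a) a| = `|a| ^+ 2
}.
#[short(type="cstarType")]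
HB.structure Definition CStarAlgebra (R : realType) :=
  {A of CompleteNormedModule R[i] A & isCStarAlgebra R A}.

Notation "a *c b" := (cmul a b) (at level 40, left associativity).
Notation "a ^c*" := (cstar a) (at level 2, format "a ^c*").

HB.mixin Record isHilbert (R : realType) H of CompleteNormedModule R[i] H := {
  inner : H -> H -> R[i];
  innerPl : forall (k : R[i]) x y z, inner (k *: x + y) z = k * inner x z + inner y z;
  innerC : forall x y, inner y x = (inner x y)^*;
  inner_norm : forall x, inner x x = `|x| ^+ 2
}.
#[short(type="hilbertType")]
HB.structure Definition Hilbert (R : realType) :=
  {H of CompleteNormedModule R[i] H & isHilbert R H}.

Notation "<[ x , y ]>" := (inner x y) (at level 0, format "<[ x ,  y ]>").

Section Operators.
Variables (R : realType) (H : hilbertType R).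
Implicit Types x y z : H.

Lemma inner0l x : <[0, x]> = 0.
Proof.
by apply: (addrI <[0, x]>); rewrite -{1}[<[0, x]>]mul1r -innerPl scaler0 !addr0.
Qed.

Lemma innerDl x y z : <[x + y, z]> = <[x, z]> + <[y, z]>.
Proof. by rewrite -[x in LHS]scale1r innerPl mul1r. Qed.

Lemma innerZl (k : R[i]) x y : <[k *: x, y]> = k * <[x, y]>.
Proof. by rewrite -[k *: x]addr0 innerPl inner0l addr0. Qed.

Lemma innerDr x y z : <[x, y + z]> = <[x, y]> + <[x, z]>.
Proof. by rewrite innerC innerDl rmorphD /= -!innerC. Qed.

Lemma innerZr (k : R[i]) x y : <[x, k *: y]> = k^* * <[x, y]>.
Proof. by rewrite innerC innerZl rmorphM /= -innerC. Qed.

Lemma inner_inj x y : (forall z, <[z, x]> = <[z, y]>) -> x = y.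
Proof.
move=> xy; apply/eqP; rewrite -subr_eq0 -normr_eq0 -sqrf_eq0 -inner_norm.
by rewrite -scaleN1r innerDr xy innerZr rmorphN rmorph1 mulN1r subrr.
Qed.

Lemma cauchy_schwarz x y : `|<[x, y]>| <= `|x| * `|y|.
Proof.
have [->|z0] := eqVneq <[x, y]> 0; first by rewrite normr0 mulr_ge0.
pose n : R[i] := `|<[x, y]>|; pose k : R[i] := <[x, y]> / n.
have n0 : n != 0 by rewrite normr_eq0.
have nC : n^* = n by rewrite conj_normC.
have kC : k^* * <[x, y]> = n.
  by rewrite rmorphM fmorphV /= nC mulrAC [_^* * _]mulrC -normCK expr2 mulfK.
have k1 : `|k| = 1 by rewrite normrM normfV normr_id divff.
have : `|x + k *: y| ^+ 2 <= (`|x| + `|y|) ^+ 2.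
  rewrite lerXn2r ?nnegrE ?addr_ge0 //.
  by apply: (le_trans (ler_normD _ _)); rewrite normrZ k1 mul1r.
rewrite -inner_norm innerDl !innerDr inner_norm innerZr kC.
rewrite (innerC x (k *: y)) innerZr kC nC innerZl innerZr mulrA -normCK.
rewrite k1 expr1n mul1r inner_norm sqrrD.
by rewrite -!addrA lerD2l !addrA lerD2r -mulr2n lerMn2r.
Qed.

(* B(H). Each bounded operator is stored with its adjoint, which exists and is
   unique by the Riesz representation theorem. *)
Record boundedOp := BoundedOp {
  op_fun :> H -> H;
  op_adj : H -> H;
  op_linear : linear op_fun;
  op_bounded : exists M : R[i], forall x, `|op_fun x| <= M * `|x|;
  op_adjP : forall x y, <[op_fun x, y]> = <[x, op_adj y]>
}.

Lemma boundedOpP (S T : boundedOp) : (forall x, S x = T x) -> S = T.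
Proof.
case: S T => [S S' Sl Sb SP] [T T' Tl Tb TP] /= ST.
have E : S = T by exact/funext.
subst T; have E : S' = T'.
  by apply/funext => y; apply: inner_inj => x; rewrite -SP -TP.
by subst T'; congr BoundedOp; exact: Prop_irrelevance.
Qed.

Lemma op_adj_swap (T : boundedOp) x y : <[op_adj T x, y]> = <[x, T y]>.
Proof. by rewrite innerC -op_adjP -innerC. Qed.

Fact op_adj_linear (T : boundedOp) : linear (op_adj T).
Proof.
move=> k x y; apply: inner_inj => z.
by rewrite innerDr innerZr -!op_adjP innerDr innerZr.
Qed.

Fact op_adj_bounded (T : boundedOp) :
  exists M : R[i], forall x, `|op_adj T x| <= M * `|x|.
Proof.
have [M TM] := op_bounded T; exists M => y.
have [->|Ty0] := eqVneq (op_adj T y) 0.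
  by rewrite normr0; exact: le_trans (TM y).
have Ty_gt0 : 0 < `|op_adj T y| by rewrite normr_gt0.
rewrite -(ler_pM2l Ty_gt0) -expr2 -inner_norm -op_adjP.
have -> : <[T (op_adj T y), y]> = `|<[T (op_adj T y), y]>|.
  by rewrite op_adjP inner_norm ger0_norm ?exprn_ge0.
apply: (le_trans (cauchy_schwarz _ _)); rewrite mulrCA mulrA.
by apply: ler_wpM2r => //; exact: TM.
Qed.

Definition adj_op (T : boundedOp) :=
  BoundedOp (op_adj_linear T) (op_adj_bounded T) (op_adj_swap T).

Fact comp_op_linear (S T : boundedOp) : linear (S \o T).
Proof. by move=> k x y /=; rewrite !op_linear. Qed.

Fact comp_op_bounded (S T : boundedOp) :
  exists M : R[i], forall x, `|(S \o T) x| <= M * `|x|.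
Proof.
have op_bd (U : boundedOp) : exists2 M, 0 <= M & forall x, `|U x| <= M * `|x|.
  have [M UM] := op_bounded U; exists `|M| => // x.
  rewrite -[`|x|]normr_id -normrM (ger0_norm (le_trans _ (UM x))) //.
have [M M0 SM] := op_bd S; have [N _ TN] := op_bd T.
exists (M * N) => x /=; apply: (le_trans (SM _)).
by rewrite -mulrA ler_wpM2l.
Qed.

Fact comp_op_adjP (S T : boundedOp) x y :
  <[(S \o T) x, y]> = <[x, (op_adj T \o op_adj S) y]>.
Proof. by rewrite /= !op_adjP. Qed.

Definition comp_op (S T : boundedOp) :=
  BoundedOp (comp_op_linear S T) (comp_op_bounded S T) (comp_op_adjP S T).

Fact id_op_bounded : exists M : R[i], forall x, `|idfun x| <= M * `|x|.
Proof. by exists 1 => x; rewrite mul1r. Qed.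

Definition id_op :=
  @BoundedOp idfun idfun (fun _ _ _ => erefl) id_op_bounded (fun _ _ => erefl).

HB.instance Definition _ := gen_eqMixin boundedOp.
HB.instance Definition _ := gen_choiceMixin boundedOp.

Fact comp_opA : associative comp_op.
Proof. by move=> S T U; apply: boundedOpP. Qed.
Fact comp_1op : left_id id_op comp_op.
Proof. by move=> S; apply: boundedOpP. Qed.
Fact adj_opK : involutive adj_op.
Proof. by move=> S; apply: boundedOpP. Qed.
Fact adj_opM : {morph adj_op : S T / comp_op S T >-> comp_op T S}.
Proof. by move=> S T; apply: boundedOpP. Qed.

(* In a starMonoidType, inv is only required to be an anti-multiplicative
   involution; here it is the adjoint. *)
HB.instance Definition _ := isStarMonoid.Build boundedOp
  comp_opA comp_1op adj_opK adj_opM.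
End Operators.

Section Multipliers.
Variables (R : realType) (B : cstarType R).
Implicit Types a b : B.

(* M(B) as the double centralizers of B: m b = mulL m b and b m = mulR m b.
   Linearity and boundedness of mulL and mulR are automatic. *)
Record multiplier := Multiplier {
  mulL : B -> B;
  mulR : B -> B;
  multiplierE : forall a b, a *c mulL b = mulR a *c b
}.

Lemma multiplier_ext (m m' : multiplier) :
  mulL m = mulL m' -> mulR m = mulR m' -> m = m'.
Proof.
case: m m' => [L S mE] [L' S' mE'] /= e e'; subst L' S'.
by congr Multiplier; exact: Prop_irrelevance.
Qed.

Fact mult_one_subproof a b : a *c idfun b = idfun a *c b. Proof. by []. Qed.

Fact mult_mul_subproof (m n : multiplier) a b :
  a *c (mulL m \o mulL n) b = (mulR n \o mulR m) a *c b.
Proof. by rewrite /= !multiplierE. Qed.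

Fact mult_adj_subproof (m : multiplier) a b :
  a *c (cstar \o mulR m \o cstar) b = (cstar \o mulL m \o cstar) a *c b.
Proof.
by apply: (can_inj cstarK); rewrite /= !cstarM !cstarK multiplierE.
Qed.

Definition mult_one := Multiplier mult_one_subproof.
Definition mult_mul m n := Multiplier (mult_mul_subproof m n).
Definition mult_adj m := Multiplier (mult_adj_subproof m).

HB.instance Definition _ := gen_eqMixin multiplier.
HB.instance Definition _ := gen_choiceMixin multiplier.

Fact mult_mulA : associative mult_mul.
Proof. by move=> m n p; apply: multiplier_ext. Qed.

Fact mult_mul1 : left_id mult_one mult_mul.
Proof. by move=> m; apply: multiplier_ext. Qed.

Fact mult_adjK : involutive mult_adj.
Proof.
by move=> m; apply: multiplier_ext; apply/funext => a /=; rewrite !cstarK.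
Qed.

Fact mult_adjM : {morph mult_adj : m n / mult_mul m n >-> mult_mul n m}.
Proof.
by move=> m n; apply: multiplier_ext; apply/funext => a /=; rewrite !cstarK.
Qed.

HB.instance Definition _ := isStarMonoid.Build multiplier
  mult_mulA mult_mul1 mult_adjK mult_adjM.

Fact mult_of_subproof (b a c : B) : a *c (b *c c) = (a *c b) *c c.
Proof. exact: cmulA. Qed.

Definition mult_of b := Multiplier (mult_of_subproof b).

End Multipliers.

(* The closed linear span of S is the whole space when total_in S. *)
Definition lin_span (K : numFieldType) (V : normedModType K) (S : set V) : set V :=
  [set v | exists (n : nat) (c : 'I_n -> K) (w : 'I_n -> V),
     (forall i, S (w i)) /\ v = \sum_i c i *: w i].

Definition total_in (K : numFieldType) (V : normedModType K) (S : set V) : Prop :=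
  closure (lin_span S) = [set: V].

Section Homomorphisms.
Variable R : realType.

Record star_hom (A B : cstarType R) (f : A -> B) : Prop := StarHom {
  hom_linear : linear f;
  hom_mul : forall a b, f (a *c b) = f a *c f b;
  hom_star : forall a, f a^c* = (f a)^c*
}.

Definition nondegenerate_hom (A B : cstarType R) (f : A -> B) : Prop :=
  star_hom f /\ total_in [set b | exists a c, b = f a *c c].

Record representation (A : cstarType R) (H : hilbertType R) (f : A -> boundedOp H)
    : Prop := Representation {
  rep_linear : forall (k : R[i]) a b h, f (k *: a + b) h = k *: f a h + f b h;
  rep_mul : forall a b, f (a *c b) = (f a * f b)%g;
  rep_star : forall a, f a^c* = adj_op (f a)
}.

Definition nondegenerate_rep (A : cstarType R) (H : hilbertType R)
    (f : A -> boundedOp H) : Prop :=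
  representation f /\ total_in [set h | exists a k, h = f a k].

(* T is the image of m under the extension of the non-degenerate
   representation f to M(B). *)
Definition extends_to (B : cstarType R) (H : hilbertType R)
    (f : B -> boundedOp H) (m : multiplier B) (T : boundedOp H) : Prop :=
  forall b h, T (f b h) = f (mulL m b) h.

End Homomorphisms.

Section Actions.
Variables (R : realType) (G : orderedGroup) (A : cstarType R).

Record endo_action := EndoAction {
  act :> posCone G -> A -> A;
  act_hom : forall s, star_hom (act s);
  act0 : forall a, act 0 a = a;
  actD : forall s t a, act (s + t) a = act s (act t a)
}.

(* Actions by automorphisms; auto_inv s is the inverse of the automorphism
   by which s acts. *)
Record auto_action := AutoAction {
  auto_act :> endo_action;
  auto_inv : posCone G -> A -> A;
  auto_actK : forall s, cancel (auto_act s) (auto_inv s);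
  auto_invK : forall s, cancel (auto_inv s) (auto_act s)
}.

End Actions.

Section StarMonoid.
Variable M : starMonoidType.
Local Open Scope group_scope.
Implicit Types v : M.
Definition isometry v := v^-1 * v = 1.
Definition partial_isometry v := v * v^-1 * v = v.
End StarMonoid.

(* The involution of a starMonoidType; it is not an inverse in B(H) and M(B). *)
Notation "v ^adj" := (v^-1)%g (at level 2, format "v ^adj").

(* Covariant pairs, with values in B(H) or in M(B). *)
Section Covariance.
Variables (R : realType) (G : orderedGroup) (A : cstarType R).
Variables (beta : endo_action G A) (M : starMonoidType).
Variables (pi : A -> M) (V : posCone G -> M).
Local Open Scope group_scope.

Record covariant_iso : Prop := CovariantIso {
  ciso_isometry : forall s, isometry (V s);
  ciso_mul : forall s t, V s * V t = V (s + t)%R;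
  ciso_cov : forall s a, pi (beta s a) = V s * pi a * (V s)^adj
}.

Record covariant_piso : Prop := CovariantPiso {
  cpiso_partial_isometry : forall s, partial_isometry (V s);
  cpiso_mul : forall s t, V s * V t = V (s + t)%R;
  cpiso_cov : forall s a, pi (beta s a) = V s * pi a * (V s)^adj;
  cpiso_comm : forall s a, (V s)^adj * V s * pi a = pi a * ((V s)^adj * V s)
}.

End Covariance.

Section CrossedProducts.
Variables (R : realType) (G : orderedGroup) (A : cstarType R).
Variable (alpha : endo_action G A).
Variables (B : cstarType R) (i_A : A -> B) (i_G : posCone G -> multiplier B).

Definition crossed_span : set B :=
  [set b | exists s a t, b = mulR (i_G t) (mulL (i_G s)^adj (i_A a))].

(* Extendibility of the endomorphisms is not used in the universal property, so
   it is not required here. Uniqueness of rho together with icp_covariant gives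
   the bijection between covariant pairs and non-degenerate representations. *)
Record isometric_crossed_product : Prop := IsometricCrossedProduct {
  icp_nondegenerate : nondegenerate_hom i_A;
  icp_covariant : covariant_iso alpha (@mult_of R B \o i_A) i_G;
  icp_universal : forall (H : hilbertType R) (pi : A -> boundedOp H)
      (V : posCone G -> boundedOp H),
    nondegenerate_rep pi -> covariant_iso alpha pi V ->
    exists! rho : B -> boundedOp H, [/\ nondegenerate_rep rho,
      forall a, rho (i_A a) = pi a & forall s, extends_to rho (i_G s) (V s)];
  icp_span : total_in crossed_span
}.

(* The partial-isometric crossed product is determined by these properties up to
   isomorphism only: a C*-algebra is isomorphic to it when it carries maps i_A
   and i_G with these properties. *)
Record partial_isometric_crossed_product : Prop := PartialIsometricCrossedProduct {
  picp_nondegenerate : nondegenerate_hom i_A;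
  picp_covariant : covariant_piso alpha (@mult_of R B \o i_A) i_G;
  picp_universal : forall (H : hilbertType R) (pi : A -> boundedOp H)
      (V : posCone G -> boundedOp H),
    nondegenerate_rep pi -> covariant_piso alpha pi V ->
    exists rho : B -> boundedOp H, [/\ nondegenerate_rep rho,
      forall a, rho (i_A a) = pi a & forall s, extends_to rho (i_G s) (V s)];
  picp_span : total_in crossed_span
}.

End CrossedProducts.

Section Tensor.
Variables (R : realType) (B A T : cstarType R) (t : B -> A -> T).

(* T is a completion of the algebraic tensor product of B and A in a C*-norm,
   with t b a the elementary tensor; tensor_faithful says that the algebraic
   tensor product embeds in T. Every C*-norm is a cross norm (tensor_norm), and
   when B is commutative, hence nuclear, it is unique, so that T is then
   determined up to isomorphism. *)
Record cstar_tensor : Prop := CStarTensor {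
  tensor_linearl : forall (k : R[i]) b b' a, t (k *: b + b') a = k *: t b a + t b' a;
  tensor_linearr : forall b (k : R[i]) a a', t b (k *: a + a') = k *: t b a + t b a';
  tensor_mul : forall b b' a a', t (b *c b') (a *c a') = t b a *c t b' a';
  tensor_star : forall b a, (t b a)^c* = t b^c* a^c*;
  tensor_faithful : forall (n : nat) (b : 'I_n -> B) (a : 'I_n -> A),
    (forall c : 'I_n -> R[i], \sum_i c i *: b i = 0 -> forall i, c i = 0) ->
    \sum_i t (b i) (a i) = 0 -> forall i, a i = 0;
  tensor_norm : forall b a, `|t b a| = `|b| * `|a|;
  tensor_dense : total_in [set x | exists b a, x = t b a]
}.
End Tensor.

Section ComplexNorm.
Variable R : realType.

Lemma normc_le_ReIm (z : R[i]) :
  `|z| <= (`|complex.Re z| + `|complex.Im z|)%:C%C.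
Proof.
case: z => a b; rewrite normc_def /= lecR.
rewrite -[leRHS]ger0_norm ?addr_ge0 // -sqrtr_sqr ler_wsqrtr //.
rewrite sqrrD !real_normK ?num_real // lerD2r lerDl.
by rewrite mulrn_wge0 // mulr_ge0.
Qed.

Lemma normc_ge_Im (z : R[i]) : `|complex.Im z|%:C%C <= `|z|.
Proof.
case: z => a b /=; rewrite normc_def /= lecR -sqrtr_sqr ler_wsqrtr //.
by rewrite lerDr sqr_ge0.
Qed.

End ComplexNorm.

Section TranslationAlgebra.
Variables (R : realType) (G : orderedGroup).
Local Notation C := R[i].
Local Notation P := (posCone G).
Implicit Types (f g : P -> C) (s t x : P).

Definition indic s : P -> C := fun x => if pos_val s <= pos_val x then 1 else 0.

(* The closed span of the functions 1_s in l^oo(P), for the supremum norm. *)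
Definition in_BG f : Prop := forall e : R, 0 < e ->
  exists (n : nat) (c : 'I_n -> C) (s : 'I_n -> P),
    forall x, `|f x - \sum_i c i * indic (s i) x| <= e%:C%C.

Fact in_BG_lim f :
  (forall e : R, 0 < e -> exists2 g, in_BG g & forall x, `|f x - g x| <= e%:C%C) ->
  in_BG f.
Proof.
move=> fg e e0; have e2 : 0 < e / 2 by rewrite divr_gt0.
have [g gB fge] := fg _ e2; have [n [c [s gs]]] := gB _ e2.
exists n, c, s => x; rewrite [e]splitr rmorphD /=.
by apply: (le_trans (ler_distD (g x) _ _)); exact: lerD.
Qed.

Fact in_BG_bounded f : in_BG f -> exists M : R, forall x, `|f x| <= M%:C%C.
Proof.
move=> /(_ 1 ltr01) [n [c [s fs]]].
exists (1 + \sum_i Normc.normc (c i)) => x; rewrite -[f x](subrK (\sum_i c i * indic (s i) x)).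
apply: (le_trans (ler_normD _ _)); rewrite rmorphD lerD //= rmorph_sum /=.
apply: (le_trans (ler_norm_sum _ _ _)); apply: ler_sum => i _.
change (`|c i * indic (s i) x| <= `|c i|).
rewrite normrM -[leRHS]mulr1 ler_wpM2l //.
by rewrite /indic; case: ifP; rewrite ?normr1 ?normr0.
Qed.

Fact in_BG_comb n (c : 'I_n -> C) (s : 'I_n -> P) :
  in_BG (fun x => \sum_i c i * indic (s i) x).
Proof. by move=> e e0; exists n, c, s => x; rewrite subrr normr0 lecR ltW. Qed.

Fact in_BG_indic s : in_BG (indic s).
Proof.
have -> : indic s = fun x => \sum_(i < 1) 1 * indic s x.
  by apply/funext => x; rewrite big_ord1 mul1r.
exact: in_BG_comb.
Qed.

Fact in_BG0 : in_BG (fun=> 0).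
Proof.
have -> : (fun=> 0) = fun x : P => \sum_(i < 0) (0 : C) * indic 0 x.
  by apply/funext => x; rewrite big_ord0.
exact: in_BG_comb.
Qed.

Fact in_BGD f g : in_BG f -> in_BG g -> in_BG (fun x => f x + g x).
Proof.
move=> fB gB e e0; have e2 : 0 < e / 2 by rewrite divr_gt0.
have [n [c [s fs]]] := fB _ e2; have [m [d [t gt]]] := gB _ e2.
exists (n + m)%N, (fun i : 'I_(n + m) => match fintype.split i with inl j => c j | inr j => d j end).
exists (fun i : 'I_(n + m) => match fintype.split i with inl j => s j | inr j => t j end) => x.
rewrite big_split_ord /=.
under eq_bigr => i _ do rewrite (unsplitK (inl i)).
under [X in _ - (_ + X)]eq_bigr => i _ do rewrite (unsplitK (inr i)).
rewrite opprD addrACA [e]splitr rmorphD /=.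
by apply: (le_trans (ler_normD _ _)); exact: lerD.
Qed.

Fact in_BGZ k f : in_BG f -> in_BG (fun x => k * f x).
Proof.
move=> fB e e0; have [->|k0] := eqVneq k 0.
  have [n [c [s fs]]] := in_BG0 e0; exists n, c, s => x.
  by rewrite mul0r; exact: fs.
have nk0 : 0 < complex.Re `|k| by rewrite -ltcR RRe_real ?normr_real // normr_gt0.
have [n [c [s fs]]] := fB _ (divr_gt0 e0 nk0).
exists n, (fun i => k * c i), s => x.
under eq_bigr => i _ do rewrite -mulrA.
rewrite -mulr_sumr -mulrBr normrM -[`|k|]RRe_real ?normr_real //.
rewrite -[e](divfK (lt0r_neq0 nk0)) mulrC rmorphM /=.
by apply: ler_wpM2r; [exact: (normr_ge0 k)|exact: fs].
Qed.

Fact in_BG_sum n (F : 'I_n -> P -> C) :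
  (forall i, in_BG (F i)) -> in_BG (fun x => \sum_i F i x).
Proof.
elim: n F => [|n IH] F FB.
  have -> : (fun x => \sum_(i < 0) F i x) = fun=> 0.
    by apply/funext => x; rewrite big_ord0.
  exact: in_BG0.
have -> : (fun x => \sum_(i < n.+1) F i x) =
    fun x => F ord0 x + \sum_(i < n) F (lift ord0 i) x.
  by apply/funext => x; rewrite big_ord_recl.
by apply: in_BGD => //; apply: IH.
Qed.

Fact in_BG_op (op : C -> C) f : (forall z w : C, `|op z - op w| <= `|z - w|) ->
  (forall n (c : 'I_n -> C) (s : 'I_n -> P),
     in_BG (fun x => op (\sum_i c i * indic (s i) x))) ->
  in_BG f -> in_BG (fun x => op (f x)).
Proof.
move=> op1 opB fB; apply: in_BG_lim => e e0; have [n [c [s fs]]] := fB _ e0.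
exists (fun x => op (\sum_i c i * indic (s i) x)) => // x.
exact: le_trans (op1 _ _) (fs _).
Qed.

Fact in_BGC f : in_BG f -> in_BG (fun x => (f x)^*).
Proof.
apply: (in_BG_op (op := Num.conj)) => [x y|n c s].
  by rewrite -rmorphB norm_conjC.
have -> : (fun x => (\sum_i c i * indic (s i) x)^*) =
    fun x => \sum_i (c i)^* * indic (s i) x.
  apply/funext => x; rewrite rmorph_sum; apply: eq_bigr => i _.
  by rewrite rmorphM /indic; case: ifP; rewrite ?rmorph1 ?rmorph0.
exact: in_BG_comb.
Qed.

Definition pos_max s t := if pos_val s <= pos_val t then t else s.

Fact indicM s t x : indic s x * indic t x = indic (pos_max s t) x.
Proof.
rewrite /indic /pos_max; case: (boolP (pos_val s <= pos_val t)) => st.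
  case: (boolP (pos_val t <= pos_val x)) => tx; last by rewrite mulr0.
  by rewrite (le_trans st tx) mulr1.
have ts : pos_val t <= pos_val s by have /orP[|//] := og_total (pos_val s) (pos_val t); rewrite (negPf st).
case: (boolP (pos_val s <= pos_val x)) => sx; last by rewrite mul0r.
by rewrite (le_trans ts sx) mulr1.
Qed.

Fact in_BGM f g : in_BG f -> in_BG g -> in_BG (fun x => f x * g x).
Proof.
have Mi s h : in_BG h -> in_BG (fun x => indic s x * h x).
  move=> hB; apply: in_BG_lim => e e0; have [n [c [t ht]]] := hB _ e0.
  exists (fun x => \sum_i c i * indic (pos_max s (t i)) x); first exact: in_BG_comb.
  move=> x; under eq_bigr => i _ do rewrite -indicM mulrCA.
  rewrite -mulr_sumr -mulrBr normrM; apply: le_trans (ht x).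
  by rewrite ler_piMl // /indic; case: ifP; rewrite ?normr1 ?normr0.
move=> fB gB; apply: in_BG_lim => e e0.
have [M fM] := in_BG_bounded fB.
have M0 : 0 <= M by rewrite -ler0c; exact: le_trans (fM 0).
have M1 : 0 < M + 1 by rewrite ltr_wpDl.
have [n [c [t gt]]] := gB _ (divr_gt0 e0 M1).
exists (fun x => \sum_i c i * (indic (t i) x * f x)).
  by apply: in_BG_sum => i; apply: in_BGZ; apply: Mi.
move=> x; under eq_bigr => i _ do rewrite mulrA.
rewrite -mulr_suml mulrC -mulrBl normrM -[e](divfK (lt0r_neq0 M1)) rmorphM /=.
apply: ler_pM => //; apply: (le_trans (fM x)); rewrite lecR lerDl //.
Qed.

Fact pos_sub_subproof x t : pos_val t <= pos_val x -> 0 <= pos_val x - pos_val t.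
Proof.
by move=> tx; rewrite -(addNr (pos_val t)) [leRHS]addrC; apply: og_lerD.
Qed.

Definition translate t f : P -> C := fun x =>
  if pselect (pos_val t <= pos_val x) is left tx then f (PosCone (pos_sub_subproof tx))
  else 0.

Fact translate_indic t s : translate t (indic s) = indic (s + t).
Proof.
apply/funext => x; rewrite /translate /indic; case: pselect => /= [tx|ntx].
  have -> // : (pos_val s <= pos_val x - pos_val t) = (pos_val s + pos_val t <= pos_val x).
  apply/idP/idP => h.
    by have := og_lerD (pos_val t) h; rewrite addrC [leRHS]addrC subrK.
  by have := og_lerD (- pos_val t) h; rewrite addrC addrK addrC.
case: ifP => // h; case: ntx; apply: le_trans h.
have s0 : 0 <= pos_val s by case: s.
by have := og_lerD (pos_val t) s0; rewrite addr0 addrC.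
Qed.

Fact in_BG_translate t f : in_BG f -> in_BG (translate t f).
Proof.
move=> fB; apply: in_BG_lim => e e0; have [n [c [s fs]]] := fB _ e0.
exists (fun x => \sum_i c i * indic (s i + t) x); first exact: in_BG_comb.
move=> x; under eq_bigr => i _ do rewrite -translate_indic.
rewrite /translate; case: pselect => //= _.
by rewrite big1 ?subrr ?normr0 ?lecR ?ltW // => i _; rewrite mulr0.
Qed.

End TranslationAlgebra.

Section TranslationCStar.
Variables (R : realType) (G : orderedGroup).
Local Notation C := R[i].
Local Notation P := (posCone G).
Implicit Types (s t x : P).

(* The C*-algebra B_{P} for the positive cone P of G. *)
Record translationAlg := TranslationAlg {
  ta_fun :> P -> C;
  ta_in : in_BG ta_fun
}.
Local Notation B := translationAlg.
Implicit Types f g h : B.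

HB.instance Definition _ := gen_eqMixin B.
HB.instance Definition _ := gen_choiceMixin B.

Fact ta_ext f g : (forall x, f x = g x) -> f = g.
Proof.
case: f g => [f fB] [g gB] /= fg; have E : f = g by exact/funext.
by subst g; congr TranslationAlg; exact: Prop_irrelevance.
Qed.

Definition ta_zero := TranslationAlg (@in_BG0 R G).
Definition ta_add f g := TranslationAlg (in_BGD (ta_in f) (ta_in g)).
Definition ta_scale (k : C) f := TranslationAlg (in_BGZ k (ta_in f)).
Definition ta_opp f := ta_scale (-1) f.
Definition ta_mul f g := TranslationAlg (in_BGM (ta_in f) (ta_in g)).
Definition ta_conj f := TranslationAlg (in_BGC (ta_in f)).

Fact ta_addA : associative ta_add.
Proof. by move=> f g h; apply: ta_ext => x /=; rewrite addrA. Qed.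
Fact ta_addC : commutative ta_add.
Proof. by move=> f g; apply: ta_ext => x /=; rewrite addrC. Qed.
Fact ta_add0 : left_id ta_zero ta_add.
Proof. by move=> f; apply: ta_ext => x /=; rewrite add0r. Qed.
Fact ta_addN : left_inverse ta_zero ta_opp ta_add.
Proof. by move=> f; apply: ta_ext => x /=; rewrite mulN1r addNr. Qed.

HB.instance Definition _ :=
  GRing.isZmodule.Build B ta_addA ta_addC ta_add0 ta_addN.

Fact ta_scaleA (a b : C) f : ta_scale a (ta_scale b f) = ta_scale (a * b) f.
Proof. by apply: ta_ext => x /=; rewrite mulrA. Qed.
Fact ta_scale1 : left_id 1 ta_scale.
Proof. by move=> f; apply: ta_ext => x /=; rewrite mul1r. Qed.
Fact ta_scaleDr : right_distributive ta_scale +%R.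
Proof. by move=> k f g; apply: ta_ext => x /=; rewrite mulrDr. Qed.
Fact ta_scaleDl f : {morph ta_scale^~ f : a b / a + b}.
Proof. by move=> a b; apply: ta_ext => x /=; rewrite mulrDl. Qed.

HB.instance Definition _ := GRing.Zmodule_isLmodule.Build C B
  ta_scaleA ta_scale1 ta_scaleDr ta_scaleDl.

Definition ta_normR f : R := sup (range (fun x => Normc.normc (f x))).
Definition ta_norm f : C := (ta_normR f)%:C%C.

Fact ta_norm_ub f x : `|f x| <= ta_norm f.
Proof.
have [M fM] := in_BG_bounded (ta_in f).
rewrite [X in X <= _](_ : _ = (Normc.normc (f x))%:C%C) // lecR.
apply: sup_upper_bound; last by exists x.
split; first by exists (Normc.normc (f 0)); exists 0.
by exists M => _ [y _ <-]; have := fM y; rewrite -lecR.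
Qed.

Fact ta_dist_ub f g x : `|f x - g x| <= ta_norm (f - g).
Proof. by have := ta_norm_ub (f - g) x; rewrite /= mulN1r. Qed.

Fact ta_norm_le f (k : C) : (forall x, `|f x| <= k) -> ta_norm f <= k.
Proof.
move=> fk; have kR : k \is Num.real by exact/ger0_real/(le_trans _ (fk 0)).
rewrite -(RRe_real kR) lecR; apply: ge_sup.
  by exists (Normc.normc (f 0)); exists 0.
by move=> _ [x _ <-]; rewrite -lecR RRe_real //; exact: fk.
Qed.

Fact ta_norm_ge0 f : 0 <= ta_norm f.
Proof. exact: le_trans (ta_norm_ub f 0). Qed.

Fact ta_normD f g : ta_norm (f + g) <= ta_norm f + ta_norm g.
Proof.
apply: ta_norm_le => x; apply: (le_trans (ler_normD _ _)).
by apply: lerD; exact: ta_norm_ub.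
Qed.

Fact ta_normZ (k : C) f : ta_norm (k *: f) = `|k| * ta_norm f.
Proof.
apply/eqP; rewrite eq_le; apply/andP; split.
  by apply: ta_norm_le => x; rewrite normrM ler_wpM2l // ta_norm_ub.
have [->|k0] := eqVneq k 0; first by rewrite normr0 mul0r ta_norm_ge0.
rewrite mulrC -ler_pdivlMr ?normr_gt0 //; apply: ta_norm_le => x.
rewrite ler_pdivlMr ?normr_gt0 // mulrC -normrM.
exact: (ta_norm_ub (k *: f) x).
Qed.

Fact ta_norm_eq0 f : ta_norm f = 0 -> f = 0.
Proof.
move=> f0; apply: ta_ext => x /=; apply/eqP; rewrite -normr_le0 -f0.
exact: ta_norm_ub.
Qed.

HB.instance Definition _ :=
  Lmodule_isNormed.Build C B ta_normD ta_normZ ta_norm_eq0.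

Fact ta_complete (F : set_system B) : ProperFilter F -> cauchy F -> cvg F.
Proof.
move=> FF /cauchy_ballP Fc.
have part (p : C -> R) x : (forall z w, p (z - w) = p z - p w) ->
    (forall z, `|p z|%:C%C <= `|z|) -> cvg ((fun f => p (f x)) @ F).
  move=> pB ple; apply: cauchy_cvg; apply/cauchy_ballP => e e0.
  have e0' : 0 < e%:C%C :> C by rewrite ltcR.
  have [[U V] /= [FU FV] UV] := Fc _ e0'.
  exists ((fun f => p (f x)) @` U, (fun f => p (f x)) @` V).
    by split => /=; [apply: filterS FU | apply: filterS FV] => f fU; exists f.
  move=> [_ _] /= [[f fU <-] [g gV <-]].
  have := UV (f, g) (conj fU gV); rewrite -!ball_normE /= => fg.
  rewrite -ltcR -pB; apply: le_lt_trans (ple _) _; apply: le_lt_trans fg.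
  exact: ta_dist_ub.
have ReC x : cvg ((fun f => complex.Re (f x)) @ F).
  by apply: (part (@complex.Re R)) => [z w|]; [rewrite raddfB | exact: normc_ge_Re].
have ImC x : cvg ((fun f => complex.Im (f x)) @ F).
  by apply: (part (@complex.Im R)) => [z w|]; [rewrite raddfB | exact: normc_ge_Im].
pose l x := (lim ((fun f => complex.Re (f x)) @ F) +i*
             lim ((fun f => complex.Im (f x)) @ F))%C.
have lim_le e : 0 < e ->
    F [set f | forall x, `|f x - l x| <= (e + (e + e))%:C%C].
  move=> e0; have e0' : 0 < e%:C%C :> C by rewrite ltcR.
  have [[U V] /= [FU FV] UV] := Fc _ e0'.
  apply: filterS FU => f fU x; near F => g.
  have gV : V g by near: g.
  rewrite rmorphD /=; apply: (le_trans (ler_distD (g x) _ _)); apply: lerD.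
    have := UV (f, g) (conj fU gV); rewrite -!ball_normE /= => /ltW.
    exact: (le_trans (ta_dist_ub f g x)).
  apply: (le_trans (normc_le_ReIm _)); rewrite lecR; apply: lerD.
    have : `|complex.Re (l x) - complex.Re (g x)| < e.
      by near: g; move/cvgrPdist_lt : (ReC x); exact.
    by rewrite distrC raddfB => /ltW.
  have : `|complex.Im (l x) - complex.Im (g x)| < e.
    by near: g; move/cvgrPdist_lt : (ImC x); exact.
  by rewrite distrC raddfB => /ltW.
have lB : in_BG l.
  apply: in_BG_lim => e e0; have e3 : 0 < e / 3 by rewrite divr_gt0.
  have [f fl] := filter_ex (lim_le _ e3).
  exists f; first exact: ta_in.
  move=> x; rewrite distrC; apply: (le_trans (fl x)); rewrite lecR; lra.
apply/cvg_ex; exists (TranslationAlg lB); apply/cvgrPdist_le => e e0.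
have eR : e \is Num.real by exact: gtr0_real.
have e3 : 0 < complex.Re e / 3 by rewrite divr_gt0 // -ltcR RRe_real.
apply: filterS (lim_le _ e3) => f fl; apply: ta_norm_le => x.
rewrite /= mulN1r distrC; apply: (le_trans (fl x)).
by rewrite -[leRHS](RRe_real eR) lecR; lra.
Unshelve. all: by end_near.
Qed.

HB.instance Definition _ := Uniform_isComplete.Build B ta_complete.

Fact ta_mulA : associative ta_mul.
Proof. by move=> f g h; apply: ta_ext => x /=; rewrite mulrA. Qed.
Fact ta_mulPl (k : C) f g h : ta_mul (k *: f + g) h = k *: ta_mul f h + ta_mul g h.
Proof. by apply: ta_ext => x /=; rewrite mulrDl mulrA. Qed.
Fact ta_mulPr (k : C) f g h : ta_mul f (k *: g + h) = k *: ta_mul f g + ta_mul f h.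
Proof. by apply: ta_ext => x /=; rewrite mulrDr mulrCA. Qed.
Fact ta_conjP (k : C) f g : ta_conj (k *: f + g) = k^* *: ta_conj f + ta_conj g.
Proof. by apply: ta_ext => x /=; rewrite rmorphD rmorphM. Qed.
Fact ta_conjK : involutive ta_conj.
Proof. by move=> f; apply: ta_ext => x /=; rewrite conjCK. Qed.
Fact ta_conjM f g : ta_conj (ta_mul f g) = ta_mul (ta_conj g) (ta_conj f).
Proof. by apply: ta_ext => x /=; rewrite rmorphM mulrC. Qed.
Fact ta_normM f g : `|ta_mul f g| <= `|f| * `|g|.
Proof.
by apply: ta_norm_le => x; rewrite normrM ler_pM //; exact: ta_norm_ub.
Qed.
Fact ta_norm_star f : `|ta_mul (ta_conj f) f| = `|f| ^+ 2.
Proof.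
apply/eqP; rewrite eq_le; apply/andP; split.
  apply: ta_norm_le => x; rewrite normrM norm_conjC expr2.
  by apply: ler_pM => //; exact: ta_norm_ub.
set n := `|ta_mul _ _|; have n0 : 0 <= n by exact: ta_norm_ge0.
have : `|f| <= sqrtC n.
  apply: ta_norm_le => x.
  rewrite -(@ler_pXn2r _ 2) ?nnegrE ?sqrtC_ge0 // sqrtCK normCKC.
  rewrite -[_ * _]ger0_norm; last by rewrite mulrC mul_conjC_ge0.
  exact: (ta_norm_ub (ta_mul (ta_conj f) f) x).
by rewrite -(@ler_pXn2r _ 2) ?nnegrE ?sqrtC_ge0 // sqrtCK.
Qed.

HB.instance Definition _ := isCStarAlgebra.Build R B
  ta_mulA ta_mulPl ta_mulPr ta_conjP ta_conjK ta_conjM ta_normM ta_norm_star.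

Definition ta_indic s : B := TranslationAlg (@in_BG_indic R G s).
Definition ta_one : B := ta_indic 0.
Definition tau_fun t f : B := TranslationAlg (in_BG_translate t (ta_in f)).

Fact tau_indic t s : tau_fun t (ta_indic s) = ta_indic (s + t).
Proof. by apply: ta_ext => x /=; rewrite translate_indic. Qed.

Fact tau_hom t : star_hom (tau_fun t).
Proof.
split=> [k f g|f g|f]; apply: ta_ext => x /=; rewrite /translate;
  by case: pselect => //= _; rewrite ?mulr0 ?addr0 ?rmorph0.
Qed.

Fact tau0 f : tau_fun 0 f = f.
Proof.
apply: ta_ext => x /=; rewrite /translate; case: pselect => /= [x0|[]]; last by case: x.
by congr (ta_fun f); apply: val_inj; rewrite /= subr0.
Qed.

Fact tauD s t f : tau_fun (s + t) f = tau_fun s (tau_fun t f).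
Proof.
have leB (y z w : G) : (y <= z - w) = (w + y <= z).
  apply/idP/idP => h.
    by have := og_lerD w h; rewrite [leRHS]addrC subrK.
  by have := og_lerD (- w) h; rewrite addrA addNr add0r addrC.
apply: ta_ext => x /=; rewrite /translate /=.
case: pselect => /= [stx|nstx].
  have t0 : 0 <= pos_val t by case: t {stx}.
  case: pselect => /= [sx|[]].
    case: pselect => /= [tx|[]]; last by rewrite leB.
    by congr (ta_fun f); apply: val_inj; rewrite /= opprD addrA.
  by apply: le_trans stx; have := og_lerD (pos_val s) t0; rewrite addr0.
by case: pselect => //= sx; case: pselect => //= tx; case: nstx; rewrite -leB.
Qed.

Definition tau : endo_action G B := EndoAction tau_hom tau0 tauD.

End TranslationCStar.

(* Main.v *)
(* Write V for a covariant partial-isometric representation. Since alpha acts by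
   automorphisms, V_s V_s^* = 1, so that W_s = V_s^* is an isometry and the
   projections V_s^* V_s decrease in s and commute with pi(A). Hence
   1_s (x) a |-> V_s^* V_s pi(a) is a representation of B (x) A, covariant with W
   for gamma, and the universal property of the isometric crossed product applies
   to it. It is bounded: an element sum_i 1_(s_i) (x) a_i has the values
   sum_(s_i <= x) a_i, whose norms are at most its tensor norm (multiply by an
   indicator function which separates x from the s_i > x) and bound its image,
   which is block diagonal along the decreasing projections.
   In the other direction, 1_s (x) a = gamma_s(1 (x) alpha_s(a)) and j_G(s) j_G(s)^*
   acts on j as the multiplication by 1_s, which gives
   j(1 (x) a) j_G(s) = j_G(s) j(1 (x) alpha_s(a)) and hence the covariance of k; the
   spanning elements of one crossed product are then spanning elements of the other.

   No spectral theory is used: norm estimates in a C*-algebra come from the fact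
   that p^* q = q^* p implies |p + i q| = |p - i q|, so |p| <= |p + i q|. *)

From mathcomp Require Import all_boot all_order all_algebra.
From mathcomp Require Import complex.
From mathcomp Require Import boolp classical_sets reals.
From mathcomp Require Import topology normedtype sequences.
From mathcomp Require Import ring.
Require Import Defs.

Set Implicit Arguments.
Unset Strict Implicit.
Unset Printing Implicit Defensive.

Import Order.TTheory GRing.Theory Num.Theory.
Import numFieldNormedType.Exports.

Local Open Scope classical_set_scope.
Local Open Scope ring_scope.

(** * Lipschitz maps and closed spans *)

Section ClosedSpan.
Variables (K : numFieldType).
Implicit Types (U V W : normedModType K).

Definition lipschitz_map V W (f : V -> W) : Prop :=
  exists M : K, forall x y, `|f x - f y| <= M * `|x - y|.

(** Two distinct points make M |x - y| nonnegative and hence [M] too; on a space with at most one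
    point any constant serves. *)
Lemma lipschitz_mapP V W (f : V -> W) : lipschitz_map f ->
  exists2 M : K, 0 < M & forall x y, `|f x - f y| <= M * `|x - y|.
Proof.
case=> M fM; have [[x [y xy]]|nxy] := pselect (exists x y : V, x != y); last first.
  exists 1 => // x y; have -> : x = y; last by rewrite !subrr !normr0 mulr0.
  by apply: contrapT => /eqP xy; apply: nxy; exists x, y.
have : 0 <= M * `|x - y| by exact: le_trans (fM x y).
rewrite pmulr_lge0 ?normr_gt0 ?subr_eq0 // => M0.
exists (M + 1); first by rewrite ltr_wpDl.
by move=> {x y xy} x y; apply: (le_trans (fM x y)); apply: ler_wpM2r; rewrite ?lerDl.
Qed.

Lemma lipschitz_map_comp U V W (f : U -> V) (g : V -> W) :
  lipschitz_map f -> lipschitz_map g -> lipschitz_map (g \o f).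
Proof.
move=> [M fM] /lipschitz_mapP[N N0 gN]; exists (N * M) => x y /=.
by apply: (le_trans (gN _ _)); rewrite -mulrA ler_pM2l.
Qed.

Lemma lipschitzD V W (f g : V -> W) :
  lipschitz_map f -> lipschitz_map g -> lipschitz_map (fun x => f x + g x).
Proof.
move=> [M fM] [N gN]; exists (M + N) => x y.
rewrite opprD addrACA mulrDl; apply: (le_trans (ler_normD _ _)).
by apply: lerD.
Qed.

Lemma lipschitzZ V W (k : K) (f : V -> W) :
  lipschitz_map f -> lipschitz_map (fun x => k *: f x).
Proof.
by move=> [M fM]; exists (`|k| * M) => x y; rewrite -scalerBr normrZ -mulrA ler_wpM2l.
Qed.

Lemma lipschitz_map_id V : lipschitz_map (@idfun V).
Proof. by exists 1 => x y; rewrite mul1r. Qed.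

Lemma lipschitz_map_cst V W (w : W) : lipschitz_map (fun _ : V => w).
Proof. by exists 0 => x y; rewrite subrr normr0 mul0r. Qed.

Lemma linear_lipschitz V W (f : V -> W) (M : K) :
  linear f -> (forall x, `|f x| <= M * `|x|) -> lipschitz_map f.
Proof.
move=> lf fM; exists M => x y; apply: le_trans (fM _).
by have -> : x - y = -1 *: y + x; rewrite ?lf scaleN1r addrC.
Qed.

Lemma lipschitz_continuous V W (f : V -> W) : lipschitz_map f -> continuous f.
Proof.
move=> /lipschitz_mapP[M M0 fM] x; apply/cvgrPdist_lt => e e0.
have /cvgrPdist_lt /(_ (e / M)) : (fun y : V => y) @ x --> x by [].
rewrite divr_gt0 // => /(_ isT); apply: filterS => y /=.
by rewrite ltr_pdivlMr // mulrC; exact: le_lt_trans.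
Qed.

Lemma closureP V (S : set V) v :
  closure S v <-> forall e : K, 0 < e -> exists2 w, S w & `|v - w| < e.
Proof.
split=> [Sv e e0|Sv B /nbhs_ballP[e e0 eB]].
  by have [w [Sw]] := Sv _ (nbhsx_ballx v e e0); rewrite -ball_normE; exists w.
have [w Sw vw] := Sv _ e0; exists w; split => //; apply: eB.
by rewrite -ball_normE.
Qed.

Lemma closed_epsP V (S : set V) :
  (forall v, (forall e : K, 0 < e -> exists2 w, S w & `|v - w| < e) -> S v) -> closed S.
Proof. by move=> H v /closureP/H. Qed.

Lemma closed_preimage V W (f : V -> W) (S : set W) :
  lipschitz_map f -> closed S -> closed (f @^-1` S).
Proof. by move=> /lipschitz_continuous/continuous_closedP; exact. Qed.

Lemma closed_equalizer V W (f g : V -> W) :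
  lipschitz_map f -> lipschitz_map g -> closed [set x | f x = g x].
Proof.
move=> fl gl; have -> : [set x | f x = g x] = (fun x => f x + (-1) *: g x) @^-1` [set 0].
  apply/seteqP; split => x /=; rewrite scaleN1r; first by move=> ->; rewrite subrr.
  by move/eqP; rewrite subr_eq0 => /eqP.
apply: closed_preimage; first by apply: lipschitzD => //; exact: lipschitzZ.
by apply: accessible_closed_set1; apply: hausdorff_accessible; exact: norm_hausdorff.
Qed.

Lemma closed_norm_le V (r : K) : closed [set x : V | `|x| <= r].
Proof.
apply: closed_epsP => v H; apply/ler_addgt0Pr => e e0.
have [w /= wr vw] := H _ e0; rewrite -[v](subrK w) addrC.
by apply: (le_trans (ler_normD _ _)); apply: lerD => //; exact: ltW.
Qed.

Definition closed_subspace V (P : set V) : Prop :=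
  [/\ P 0, (forall k u v, P u -> P v -> P (k *: u + v)) & closed P].

Lemma closed_subspace_sum V (P : set V) I (r : seq I) (F : I -> V) :
  closed_subspace P -> (forall i, P (F i)) -> P (\sum_(i <- r) F i).
Proof.
move=> [P0 PD _] PF; elim/big_rec: _ => // i v _ Pv.
by rewrite -[F i]scale1r; exact: PD.
Qed.

Definition cspan V (S : set V) : set V := closure (lin_span S).

Lemma cspan_min V (S P : set V) : closed_subspace P -> S `<=` P -> cspan S `<=` P.
Proof.
move=> Ps SP; have [P0 PD cP] := Ps.
have lP : lin_span S `<=` P.
  move=> _ [n [c [w [Sw ->]]]]; apply: (closed_subspace_sum _ Ps) => i.
  by rewrite -[_ *: _]addr0; apply: PD => //; exact: SP.
move=> v /closureP Sv; apply: cP; apply/closureP => e e0.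
by have [w /lP] := Sv e e0; exists w.
Qed.

(** Serves as an induction principle: a property that cuts out a closed subspace has only to be
    checked on generators. *)
Lemma total_ind V (S P : set V) : total_in S -> closed_subspace P -> S `<=` P ->
  forall v, P v.
Proof. by move=> tS Ps SP v; apply: (cspan_min Ps SP); rewrite /cspan tS. Qed.

Lemma lin_spanD V (S : set V) k u v : lin_span S u -> lin_span S v -> lin_span S (k *: u + v).
Proof.
move=> [n [c [w [Sw ->]]]] [m [d [z [Sz ->]]]].
exists (n + m)%N, (fun i => match fintype.split i with inl j => k * c j | inr j => d j end).
exists (fun i => match fintype.split i with inl j => w j | inr j => z j end); split.
  by move=> i; case: fintype.split.
rewrite big_split_ord /= scaler_sumr; congr (_ + _); apply: eq_bigr => i _.
  by rewrite (unsplitK (inl i)) scalerA.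
by rewrite (unsplitK (inr i)).
Qed.

Lemma cspan_subspace V (S : set V) : closed_subspace (cspan S).
Proof.
split; last exact: closed_closure.
  apply/closureP => e e0; exists 0; last by rewrite subrr normr0.
  by exists 0%N, (fun=> 0), (fun=> 0); split=> [[]|] //; rewrite big_ord0.
move=> k u v /closureP Su /closureP Sv; apply/closureP => e e0.
(* The [+ 1] keeps the divisor positive when [k = 0]. *)
have k0 : 0 < `|k| + 1 :> K by rewrite ltr_wpDl.
have [u' Su' uu'] := Su _ (divr_gt0 (divr_gt0 e0 (ltr0n K 2)) k0).
have [v' Sv' vv'] := Sv _ (divr_gt0 e0 (ltr0n K 2)).
exists (k *: u' + v'); first exact: lin_spanD.
rewrite opprD addrACA -scalerBr [e]splitr; apply: (le_lt_trans (ler_normD _ _)).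
apply: ler_ltD => //; rewrite normrZ.
move/ltW: uu'; rewrite ler_pdivlMr // mulrC; apply: le_trans.
by apply: ler_wpM2r; rewrite ?lerDl.
Qed.

Lemma sub_cspan V (S : set V) : S `<=` cspan S.
Proof.
move=> v Sv; apply/closureP => e e0; exists v; last by rewrite subrr normr0.
by exists 1%N, (fun=> 1), (fun=> v); rewrite big_ord1 scale1r.
Qed.

Lemma total_inP V (S : set V) : (forall v, cspan S v) -> total_in S.
Proof. by move=> H; apply/seteqP; split=> // v _; exact: H. Qed.

Lemma closed_subspace_preimage V W (f : V -> W) (P : set W) :
  linear f -> lipschitz_map f -> closed_subspace P -> closed_subspace (f @^-1` P).
Proof.
move=> lf fl [P0 PD cP]; split; last exact: closed_preimage.
  rewrite /preimage /=; suff -> : f 0 = 0 by [].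
  by apply: (addrI (f 0)); rewrite -{1}[f 0]scale1r -lf scaler0 !addr0.
by move=> k u v Pu Pv; rewrite /preimage /= lf; exact: PD.
Qed.

Lemma closed_subspace_equalizer V W (f g : V -> W) : linear f -> linear g ->
  lipschitz_map f -> lipschitz_map g -> closed_subspace [set x | f x = g x].
Proof.
have l0 (h : V -> W) : linear h -> h 0 = 0.
  by move=> lh; apply: (addrI (h 0)); rewrite -{1}[h 0]scale1r -lh scaler0 !addr0.
move=> lf lg fl gl; split; last exact: closed_equalizer.
  by rewrite /= !l0.
by move=> k u v /= fu fv; rewrite lf lg fu fv.
Qed.

End ClosedSpan.

(** * Banach's fixed point theorem on a closed invariant set *)

Section FixedPoint.
Variables (R : realType) (X : completeNormedModType R[i]).

Lemma contraction_fixed_point (U : set X) (f : X -> X) (q : R) (x0 : X) :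
  q < 1 -> closed U -> U x0 -> (forall x, U x -> U (f x)) ->
  (forall x y, U x -> U y -> `|f x - f y| <= q%:C%C * `|x - y|) ->
  exists2 x, U x & f x = x.
Proof.
move=> q1 cU Ux0 fU fq0.
(* A negative [q] makes [f] constant on [U], and then [f x0] is a fixed point. *)
wlog q0 : q q1 fq0 / 0 <= q.
  move=> Hq; case: (lerP 0 q) => [|q0]; first exact: Hq.
  have fx x y : U x -> U y -> f x = f y.
    move=> Ux Uy; apply/eqP; rewrite -subr_eq0 -normr_le0.
    apply: (le_trans (fq0 _ _ Ux Uy)).
    by rewrite mulr_le0_ge0 // lecR ltW.
  by exists (f x0); [exact: fU|apply: fx => //; exact: fU].
pose y n := iter n f x0.
have yU n : U (y n) by elim: n => //= n; exact: fU.
have q1C : 0 < (1 - q)%:C%C :> R[i] by rewrite ltcR subr_gt0.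
pose K : R[i] := `|y 1%N - y 0%N| / (1 - q)%:C%C.
have K0 : 0 <= K by rewrite divr_ge0 // ltW.
have y1 n : `|y n.+1 - y n| <= (q ^+ n)%:C%C * (K * (1 - q)%:C%C).
  elim: n => [|n IH]; first by rewrite expr0 mul1r divfK ?gt_eqF.
  apply: (le_trans (fq0 _ _ (yU n.+1) (yU n))).
  rewrite exprS rmorphM -mulrA; apply: ler_wpM2l; first by rewrite lecR.
  exact: IH.
(* [K] is the sum of the geometric series with first term |y 1 - y 0|; the right-hand side is its
   part from index [n] to [n + m]. *)
have yd n m : `|y (n + m)%N - y n| <= (q ^+ n)%:C%C * K * (1 - (q ^+ m)%:C%C).
  elim: m => [|m IH]; first by rewrite addn0 expr0 !subrr normr0 mulr0.
  rewrite addnS; apply: (le_trans (ler_distD (y (n + m)%N) _ _)).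
  apply: (le_trans (lerD (y1 (n + m)%N) IH)).
  rewrite exprD exprS !rmorphM rmorphB /= rmorph1 le_eqVlt; apply/orP; left; apply/eqP.
  ring.
have yc : cauchy (y @ \oo).
  apply/cauchy_ballP => e e0.
  have eR : e \is Num.real by exact: gtr0_real.
  have KR : K \is Num.real by exact: ger0_real.
  have e0' : 0 < complex.Re e by rewrite -ltcR RRe_real.
  have : \forall n \near \oo, `|0 - complex.Re K * q ^+ n| < complex.Re e / 2.
    have := @cvg_geometric R (complex.Re K) q; rewrite ger0_norm // => /(_ q1).
    move/cvgrPdist_lt; apply; exact: divr_gt0.
  case=> N _ NP.
  have yN n : (N <= n)%N -> ball (y N) (e / 2) (y n).
    move=> /subnKC <-; rewrite -ball_normE /ball_ /= distrC.
    apply: le_lt_trans (yd _ _) _.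
    have := NP N (leqnn N); rewrite /= sub0r normrN => /(le_lt_trans (ler_norm _)).
    rewrite -ltcR !rmorphM /= fmorphV /= rmorph_nat !RRe_real // => h.
    apply: le_lt_trans h; rewrite [X in X * (1 - _)]mulrC ler_piMr //.
      by rewrite mulr_ge0 // lecR exprn_ge0.
    by rewrite gerDl oppr_le0 lecR exprn_ge0.
  exists (y @` [set n | (N <= n)%N], y @` [set n | (N <= n)%N]).
    by split; exists N => // n Nn; exists n.
  move=> [_ _] /= [[n Nn <-] [m Nm <-]].
  exact: ball_splitr (yN _ Nn) (yN _ Nm).
have yl : cvg (y @ \oo) by exact: cauchy_cvg.
have lU : U (lim (y @ \oo)).
  by apply: closed_cvg yl => //; exact: nearW.
exists (lim (y @ \oo)) => //.
have yl' : (fun n => y n.+1) @ \oo --> lim (y @ \oo).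
  by rewrite -(@cvg_shiftS _ y) in yl *.
apply: (@cvg_unique _ _ ((fun n => y n.+1) @ \oo)) => //.
apply/cvgrPdist_le => e e0.
move/cvgrPdist_le : yl => /(_ e e0); apply: filterS => n /= yn.
apply: (le_trans (fq0 _ _ lU (yU n))); apply: le_trans yn.
by rewrite ler_piMl // lecR ltW.
Qed.
End FixedPoint.

(** * Norm estimates in C*-algebras *)

Section CStarAlgebra.
Variables (R : realType) (A : cstarType R).
Implicit Types (a b c p q x z : A) (k : R[i]).

Lemma cmulDl a b c : (a + b) *c c = a *c c + b *c c.
Proof. by rewrite -[a in LHS]scale1r cmulPl scale1r. Qed.

Lemma cmul0l c : 0 *c c = 0.
Proof. by apply: (addrI (0 *c c)); rewrite -cmulDl !addr0. Qed.

Lemma cmulZl k a c : (k *: a) *c c = k *: (a *c c).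
Proof. by rewrite -[k *: a]addr0 cmulPl cmul0l addr0. Qed.

Lemma cmulNl a c : (- a) *c c = - (a *c c).
Proof. by rewrite -scaleN1r cmulZl scaleN1r. Qed.

Lemma cmulBl a b c : (a - b) *c c = a *c c - b *c c.
Proof. by rewrite cmulDl cmulNl. Qed.

Lemma cmulDr a b c : a *c (b + c) = a *c b + a *c c.
Proof. by rewrite -[b in LHS]scale1r cmulPr scale1r. Qed.

Lemma cmul0r c : c *c 0 = 0.
Proof. by apply: (addrI (c *c 0)); rewrite -cmulDr !addr0. Qed.

Lemma cmulZr k a c : c *c (k *: a) = k *: (c *c a).
Proof. by rewrite -[k *: a]addr0 cmulPr cmul0r addr0. Qed.

Lemma cmulNr a c : c *c (- a) = - (c *c a).
Proof. by rewrite -scaleN1r cmulZr scaleN1r. Qed.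

Lemma cmulBr a b c : a *c (b - c) = a *c b - a *c c.
Proof. by rewrite cmulDr cmulNr. Qed.

Lemma cstarD a b : (a + b)^c* = a^c* + b^c*.
Proof. by rewrite -[a in LHS]scale1r cstarP rmorph1 scale1r. Qed.

Lemma cstar0 : 0^c* = 0 :> A.
Proof. by apply: (addrI 0^c*); rewrite -cstarD !addr0. Qed.

Lemma cstarZ k a : (k *: a)^c* = k^* *: a^c*.
Proof. by rewrite -[k *: a]addr0 cstarP cstar0 addr0. Qed.

Lemma cstarN a : (- a)^c* = - a^c*.
Proof. by rewrite -scaleN1r cstarZ rmorphN rmorph1 scaleN1r. Qed.

Lemma cstarB a b : (a - b)^c* = a^c* - b^c*.
Proof. by rewrite cstarD cstarN. Qed.

Lemma norm_cstar a : `|a^c*| = `|a|.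
Proof.
have le b : `|b| <= `|b^c*|.
  have [->|b0] := eqVneq b 0; first by rewrite cstar0.
  have b1 : 0 < `|b| by rewrite normr_gt0.
  by rewrite -(ler_pM2r b1) -expr2 -cstar_identity ler_norm_cmul.
by apply/eqP; rewrite eq_le le -{2}[a]cstarK le.
Qed.

(** Taking for [c] the adjoint of [a - b], the C*-identity gives |a - b|^2 = 0. *)
Lemma cmul_faithfulr a b : (forall c, c *c a = c *c b) -> a = b.
Proof.
move=> ab; apply/eqP; rewrite -subr_eq0 -normr_eq0 -sqrf_eq0 -cstar_identity.
by rewrite cmulBr ab subrr normr0.
Qed.

Lemma cmul_faithfull a b : (forall c, a *c c = b *c c) -> a = b.
Proof.
move=> ab; apply: (can_inj cstarK); apply: cmul_faithfulr => c.
by apply: (can_inj cstarK); rewrite !cstarM !cstarK.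
Qed.

(** In the C*-identity for [p + 'i *: q] the cross terms are i (p^* q - q^* p), which vanishes. *)
Lemma norm_cadd_i p q : p^c* *c q = q^c* *c p ->
  `|p + 'i *: q| ^+ 2 = `|p^c* *c p + q^c* *c q|.
Proof.
move=> pq; rewrite -cstar_identity cstarD cstarZ conjCi cmulDl !cmulDr.
rewrite !cmulZl !cmulZr pq scalerA mulNr -expr2 sqrCi opprK scale1r addrCA scaleNr.
by rewrite [X in _ + X]addrAC addrC addrK. 
Qed.

Lemma norm_csub_i p q : p^c* *c q = q^c* *c p ->
  `|p - 'i *: q| ^+ 2 = `|p^c* *c p + q^c* *c q|.
Proof.
move=> pq; rewrite -scalerN norm_cadd_i ?cstarN ?cmulNl ?cmulNr ?opprK //.
by rewrite pq.
Qed.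

Lemma sqr_norm_inj (k l : R[i]) : 0 <= k -> 0 <= l -> k ^+ 2 = l ^+ 2 -> k = l.
Proof. by move=> k0 l0 /eqP; rewrite eqrXn2 // => /eqP. Qed.

Lemma ler_norm_cadd_i p q : p^c* *c q = q^c* *c p -> `|p| <= `|p + 'i *: q|.
Proof.
move=> pq; have e : `|p - 'i *: q| = `|p + 'i *: q|.
  by apply: sqr_norm_inj; rewrite // norm_csub_i // norm_cadd_i.
have : `|p *+ 2| <= `|p + 'i *: q| *+ 2.
  rewrite [in leRHS]mulr2n -{2}e; apply: le_trans (ler_normD _ _).
  by rewrite addrACA subrr addr0.
by rewrite normrMn lerMn2r.
Qed.

Lemma cmul_lipschitz_r b : lipschitz_map (cmul b).
Proof.
by apply: (@linear_lipschitz _ _ _ _ `|b|) => [k u v|u]; [exact: cmulPr|exact: ler_norm_cmul].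
Qed.

Lemma cmul_lipschitz_l b : lipschitz_map (cmul^~ b).
Proof.
apply: (@linear_lipschitz _ _ _ _ `|b|) => [k u v|u]; first exact: cmulPl.
by rewrite mulrC; exact: ler_norm_cmul.
Qed.

(* c = 1 - sqrt (1 - a^2), obtained as the fixed point of c |-> (a^2 + c^2) / 2. *)
Lemma cstar_sqrt a : a^c* = a -> `|a| < 1 ->
  exists c, [/\ c^c* = c, c *c a = a *c c & c + c - c *c c = a *c a].
Proof.
move=> sa a1; pose q : R := complex.Re `|a|.
have aR : `|a| = q%:C%C by rewrite RRe_real // normr_real.
(* The fixed point inherits every closed condition that [f] preserves, so self-adjointness and
   commutation with [a] are built into [U]. On the ball of radius |a| the map [f] has Lipschitz
   constant |a| < 1. *)
pose U := [set c : A | [/\ c^c* = c, c *c a = a *c c & `|c| <= `|a|]].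
pose f c : A := 2^-1 *: (a *c a + c *c c).
have h2 : 2^-1 + 2^-1 = 1 :> R[i] by have := splitr (1 : R[i]); rewrite mul1r.
have h20 : 0 <= 2^-1 :> R[i] by rewrite invr_ge0.
have h2c : (2^-1)^* = 2^-1 :> R[i] by rewrite fmorphV rmorph_nat.
have h2n : `|2^-1| = 2^-1 :> R[i] by rewrite ger0_norm.
have [|||||c [sc ca c1] fc] := @contraction_fixed_point R A U f q 0.
- by rewrite -ltcR -aR.
- have -> : U = [set c | c^c* = c] `&` ([set c | c *c a = a *c c] `&` [set c | `|c| <= `|a|]).
    by apply/seteqP; split => [c [? ? ?]|c [? [? ?]]].
  apply: closedI; last apply: closedI; last exact: closed_norm_le.
    apply: closed_equalizer (lipschitz_map_id _).
    by exists 1 => x y; rewrite -cstarB norm_cstar mul1r.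
  exact: closed_equalizer (cmul_lipschitz_l a) (cmul_lipschitz_r a).
- by split; rewrite ?cstar0 ?cmul0l ?cmul0r ?normr0.
- move=> c [sc ca c1]; split.
  + by rewrite cstarZ h2c cstarD !cstarM sa sc.
  + by rewrite cmulZl cmulZr cmulDl cmulDr -!cmulA ca [c *c (a *c c)]cmulA ca -!cmulA.
  + rewrite normrZ h2n; apply: (@le_trans _ _ (2^-1 * (`|a| * `|a| + `|a| * `|a|))).
      apply: ler_wpM2l => //; apply: (le_trans (ler_normD _ _)).
      apply: lerD; first exact: ler_norm_cmul.
      by apply: (le_trans (ler_norm_cmul _ _)); exact: ler_pM.
    rewrite mulrDr -mulrDl h2 mul1r ler_piMl // ltW //.
- move=> x y [sx xa x1] [sy ya y1]; rewrite -scalerBr normrZ h2n.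
  rewrite opprD addrACA subrr add0r.
  have -> : x *c x - y *c y = x *c (x - y) + (x - y) *c y.
    by rewrite cmulBl cmulBr addrA subrK.
  apply: (@le_trans _ _ (2^-1 * (`|a| * `|x - y| + `|a| * `|x - y|))).
    apply: ler_wpM2l => //; apply: (le_trans (ler_normD _ _)).
    apply: lerD; apply: (le_trans (ler_norm_cmul _ _)).
      exact: ler_wpM2r.
    by rewrite mulrC; exact: ler_wpM2r.
  by rewrite mulrDr -mulrDl h2 mul1r aR.
exists c; split => //; rewrite -{1 2}fc -scalerDl h2 scale1r.
by rewrite addrK.
Qed.


(** Square roots are available only in the open unit ball, so [a] is divided by a number [r]
    slightly larger than its norm, and the excess tends to 0 with [e]. *)
Lemma homogeneous_bound (N : A -> R[i]) (C : R[i]) :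
  (forall k a, N (k *: a) = `|k| * N a) -> 0 <= C ->
  (forall a, a^c* = a -> `|a| < 1 -> N a <= C) ->
  forall a, a^c* = a -> N a <= C * `|a|.
Proof.
move=> Nk C0 N1 a sa; apply/ler_addgt0Pr => e e0.
have C1 : 0 < C + 1 by rewrite ltr_wpDl.
set r := `|a| + e / (C + 1); have r0 : 0 < r by rewrite ltr_wpDl // divr_gt0.
have rV : 0 < r^-1 by rewrite invr_gt0.
have rr : (r^-1)^* = r^-1 by apply: conj_Creal; exact: gtr0_real.
have ar : `|a| < r by rewrite ltrDl divr_gt0.
have := N1 (r^-1 *: a); rewrite cstarZ rr sa normrZ ger0_norm; last exact: ltW.
rewrite mulrC ltr_pdivrMr // mul1r ar => /(_ erefl isT).
rewrite Nk ger0_norm; last exact: ltW.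
rewrite ler_pdivrMl // mulrC => h; apply: (le_trans h).
rewrite /r mulrDr lerD2l mulrCA ger_pMr // ler_pdivrMr // mul1r.
by rewrite lerDl.
Qed.

End CStarAlgebra.

(** * Contractivity of star-homomorphisms *)

Section Contractive.
Variables (R : realType).

Lemma star_hom0 (A B : cstarType R) (f : A -> B) : star_hom f -> f 0 = 0.
Proof.
by case=> lf _ _; apply: (addrI (f 0)); rewrite -{1}[f 0]scale1r -lf scaler0 !addr0.
Qed.

(* For a self-adjoint b with |b| < 1 and c = 1 - sqrt (1 - b^2), the element
   f b + i (1 - f c) is unitary and f b is its real part. *)
Lemma star_hom_le (A B : cstarType R) (f : A -> B) a : star_hom f -> `|f a| <= `|a|.
Proof.
move=> hf; have f0 := star_hom0 hf; case: hf => lf fM fS.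
have sale b : b^c* = b -> `|f b| <= 1 * `|b|.
  apply: (@homogeneous_bound _ _ (fun x => `|f x|)) => // [k x|{}b sb b1].
    by rewrite -[k *: x]addr0 lf f0 addr0 normrZ.
  have [c [sc cb ce]] := cstar_sqrt sb b1.
  have sfb : (f b)^c* = f b by rewrite -fS sb.
  have sfc : (f c)^c* = f c by rewrite -fS sc.
  have fcb : f c *c f b = f b *c f c by rewrite -!fM cb.
  have fce : f b *c f b = f c + f c - f c *c f c.
    rewrite -!fM -ce -[c + c - _]addrC -scaleN1r lf scaleN1r addrC; congr (_ - _).
    by rewrite -{1}[c]scale1r lf scale1r.
  (* As no unit is available, the unitary is applied to [z]: its product with [z] is [p + 'i *: q],
     of norm |z|. Since |p| = |z|^2, this gives |z|^2 <= |z|. *)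
  pose z := f b; pose p := f b *c z; pose q := z - f c *c z.
  have pq : p^c* *c q = q^c* *c p.
    rewrite /p /q cstarB !cstarM sfb sfc cmulBl cmulBr -!cmulA.
    by congr (_ - _); congr (_ *c _); rewrite !cmulA fcb.
  have pp : p^c* *c p + q^c* *c q = z^c* *c z.
    rewrite /p /q cstarB !cstarM sfb sfc cmulBl !cmulBr -!cmulA.
    rewrite [f b *c (f b *c z)]cmulA fce cmulBl cmulDl cmulBr cmulDr -!cmulA.
    by rewrite opprB addrACA addKr addrCA !addrK.
  have : `|p| <= `|z|.
    rewrite -(@ler_pXn2r _ 2) ?nnegrE // -[leRHS]cstar_identity -pp -norm_cadd_i //.
    by rewrite ler_pXn2r ?nnegrE //; exact: ler_norm_cadd_i.
  have -> : `|p| = `|z| ^+ 2 by rewrite -cstar_identity /p -{1}sfb.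
  have [->|z0] := eqVneq `|f b| 0; first by [].
  by rewrite expr2 ger_pMr // lt0r z0 /=.
(* The C*-identity reduces the general case to the self-adjoint element a^* a. *)
rewrite -(@ler_pXn2r _ 2) ?nnegrE // -!cstar_identity -fS -fM.
by apply: (le_trans (sale _ _)); rewrite ?mul1r // cstarM cstarK.
Qed.

Lemma star_hom_lipschitz (A B : cstarType R) (f : A -> B) : star_hom f -> lipschitz_map f.
Proof.
move=> hf; apply: (@linear_lipschitz _ _ _ _ 1); first by case: hf.
by move=> x; rewrite mul1r; exact: star_hom_le.
Qed.

End Contractive.

(** * Representations on a Hilbert space *)

Section HilbertSpace.
Variables (R : realType) (H : hilbertType R).
Implicit Types (x y : H).

Lemma innerNl x y : <[- x, y]> = - <[x, y]>.
Proof. by rewrite -scaleN1r innerZl mulN1r. Qed.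

Lemma innerBl x y z : <[x - y, z]> = <[x, z]> - <[y, z]>.
Proof. by rewrite innerDl innerNl. Qed.

Lemma innerNr x y : <[x, - y]> = - <[x, y]>.
Proof. by rewrite -scaleN1r innerZr rmorphN rmorph1 mulN1r. Qed.

Lemma innerBr x y z : <[x, y - z]> = <[x, y]> - <[x, z]>.
Proof. by rewrite innerDr innerNr. Qed.

Lemma op_lipschitz (T : boundedOp H) : lipschitz_map T.
Proof. by have [M TM] := op_bounded T; exact: linear_lipschitz (op_linear T) TM. Qed.

Lemma opB (T : boundedOp H) x y : T (x - y) = T x - T y.
Proof. by rewrite addrC -scaleN1r op_linear scaleN1r addrC. Qed.

Lemma op0 (T : boundedOp H) : T 0 = 0.
Proof. by rewrite -[0 in LHS](subrr 0) opB subrr. Qed.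

Lemma opD (T : boundedOp H) x y : T (x + y) = T x + T y.
Proof. by rewrite -[x in LHS]scale1r op_linear scale1r. Qed.

Lemma opZ (T : boundedOp H) k x : T (k *: x) = k *: T x.
Proof. by rewrite -[k *: x]addr0 op_linear op0 addr0. Qed.

Lemma inner_bound x (M : R[i]) : 0 <= M -> (forall y, `|<[x, y]>| <= M * `|y|) -> `|x| <= M.
Proof.
move=> M0 xM; have [->|x0] := eqVneq `|x| 0; first by [].
have x1 : 0 < `|x| by rewrite lt0r x0 /=.
by have := xM x; rewrite inner_norm normrX normr_id expr2 ler_pM2r.
Qed.

Section Representation.
Variables (A : cstarType R) (pi : A -> boundedOp H) (rpi : representation pi).
Implicit Types a b : A.

Lemma rep0 h : pi 0 h = 0.
Proof.
by apply: (addrI (pi 0 h)); rewrite -{1}[pi 0 h]scale1r -(rep_linear rpi) scaler0 !addr0.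
Qed.

Lemma repD a b h : pi (a + b) h = pi a h + pi b h.
Proof. by rewrite -[a in LHS]scale1r (rep_linear rpi) scale1r. Qed.

Lemma repZ k a h : pi (k *: a) h = k *: pi a h.
Proof. by rewrite -[k *: a]addr0 (rep_linear rpi) rep0 addr0. Qed.

Lemma repB a b h : pi (a - b) h = pi a h - pi b h.
Proof. by rewrite repD -scaleN1r repZ scaleN1r. Qed.

Lemma repM a b h : pi (a *c b) h = pi a (pi b h).
Proof. by rewrite (rep_mul rpi). Qed.

Lemma rep_inner a x y : <[pi a x, y]> = <[x, pi a^c* y]>.
Proof. by rewrite op_adjP (rep_star rpi). Qed.

(** For a self-adjoint [b] with |b| < 1 and c = 1 - sqrt (1 - b^2), the vectors [pi b h] and
    [h - pi c h] have squared norms adding up to that of [h]. The general case follows from |pi a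
    h|^2 = <h, pi (a^* a) h> and Cauchy-Schwarz. *)
Lemma rep_le a h : `|pi a h| <= `|a| * `|h|.
Proof.
have sale b : b^c* = b -> `|pi b h| <= `|h| * `|b|.
  move: b; have := @homogeneous_bound _ A (fun b => `|pi b h|) `|h|.
  apply => // [k b|b sb b1].
    by rewrite repZ normrZ.
  have [c [sc cb ce]] := cstar_sqrt sb b1.
  rewrite -(@ler_pXn2r _ 2) ?nnegrE //.
  suff <- : `|pi b h| ^+ 2 + `|h - pi c h| ^+ 2 = `|h| ^+ 2 by rewrite lerDl exprn_ge0.
  rewrite -!inner_norm rep_inner sb -repM -ce repB repD repM.
  rewrite !(innerBl, innerBr, innerDr) !rep_inner sc. ring.
rewrite mulrC -(@ler_pXn2r _ 2) ?nnegrE ?mulr_ge0 // -inner_norm rep_inner -repM.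
have -> : <[h, pi (a^c* *c a) h]> = `|<[h, pi (a^c* *c a) h]>|.
  by rewrite repM -rep_inner inner_norm normrX normr_id.
apply: (le_trans (cauchy_schwarz _ _)); rewrite exprMn -cstar_identity expr2 -mulrA.
by apply: ler_wpM2l => //; apply: sale; rewrite cstarM cstarK.
Qed.

End Representation.
End HilbertSpace.

(** * Resolvents and the density of products *)

Section Factorization.
Variables (R : realType) (A : cstarType R).
Implicit Types (a b x w z : A) (t : R[i]).

(* The resolvent 1 / (1 - i t x) of a self-adjoint x is a contraction. *)
Lemma resolvent_norm_le x w t : x^c* = x -> t^* = t ->
  `|w| <= `|w - ('i * t) *: (x *c w)|.
Proof.
move=> sx st; have -> : w - ('i * t) *: (x *c w) = w + 'i *: (- t *: (x *c w)).
  by rewrite scalerA mulrN scaleNr.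
apply: ler_norm_cadd_i.
by rewrite cstarZ cstarM sx cmulZl cmulZr rmorphN /= st cmulA.
Qed.

(* A continuation in steps of length d: since the resolvent at d n is a contraction,
   the equation at d (n + 1) is a contractive fixed point equation. *)
Lemma resolvent_surj x (d : R[i]) (n : nat) z : x^c* = x -> 0 <= d ->
  d * `|x| <= 2^-1 -> exists w, w - ('i * (d *+ n)) *: (x *c w) = z.
Proof.
move=> sx d0 dx; elim: n z => [|n IH] z.
  by exists z; rewrite mulr0n mulr0 scale0r subr0.
have [S SP] := choice IH.
(* [S] is the solution operator at [d *+ n]; [resolvent_norm_le], applied to [S u - S v], makes it a
   contraction. *)
have Slip u v : `|S u - S v| <= `|u - v|.
  have -> : u - v = (S u - S v) - ('i * (d *+ n)) *: (x *c (S u - S v)).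
    rewrite -[in LHS](SP u) -[in LHS](SP v) cmulBr scalerBr !opprB.
    by rewrite addrACA [RHS]addrACA [- S v + _]addrC.
  apply: resolvent_norm_le => //.
  by apply: conj_Creal; rewrite ger0_real // mulrn_wge0.
(* Since [S] inverts the equation at [d *+ n], a fixed point of this map solves the one at
   [d *+ n.+1]. *)
have [|||||w _ wP] := @contraction_fixed_point R A setT
    (fun w => S (z + ('i * d) *: (x *c w))) 2^-1 0.
- by rewrite invf_lt1 ?ltr1n.
- exact: closedT.
- by [].
- by [].
- move=> u v _ _; apply: (le_trans (Slip _ _)).
  rewrite opprD addrACA subrr add0r -scalerBr -cmulBr normrZ normrM normCi mul1r.
  rewrite fmorphV rmorph_nat ger0_norm //.
  apply: le_trans (ler_wpM2r _ dx) => //.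
  by rewrite -mulrA; apply: ler_wpM2l => //; exact: ler_norm_cmul.
have := SP (z + ('i * d) *: (x *c w)); rewrite wP => e.
exists w; apply: (addIr (('i * d) *: (x *c w))); rewrite -e.
by rewrite mulrS mulrDr scalerDl opprD addrA addrAC subrK.
Qed.

(* Multiplication by 1 + i t w is the resolvent. *)
Lemma resolvent_small x w t : x^c* = x -> 0 <= t ->
  w - ('i * t) *: (x *c w) = x -> t * `|w| <= 2.
Proof.
move=> sx t0 wP; have [->|w0] := eqVneq w 0; first by rewrite normr0 mulr0.
have w1 : 0 < `|w| by rewrite normr_gt0.
(* [r] is the resolvent applied to [z], so |r| <= |z| and t |w z| = |r - z| <= 2 |z|. *)
have key z : t * `|w *c z| <= `|z| *+ 2.
  pose r := z + ('i * t) *: (w *c z).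
  have rz : r - ('i * t) *: (x *c r) = z.
    rewrite /r cmulDr cmulZr scalerDr opprD addrA -[RHS]addr0 -!addrA.
    congr (_ + _); rewrite addrA -scalerBr -scalerBr cmulA -cmulBl -cmulZl -cmulBl.
    rewrite addrAC wP subrr cmul0l scaler0 //.
  have : `|r| <= `|z|.
    rewrite -[leRHS]/(`|z|) -rz; apply: resolvent_norm_le => //.
    by apply: conj_Creal; rewrite ger0_real.
  move=> rle; have -> : t * `|w *c z| = `|r - z|.
    by rewrite /r addrC addKr normrZ normrM normCi mul1r ger0_norm.
  by apply: (le_trans (ler_normB _ _)); rewrite mulr2n lerD2r.
(* At the adjoint of [w] the left side becomes t |w|^2, and one factor |w| cancels. *)
have := key w^c*; rewrite -{1}[w]cstarK cstar_identity !norm_cstar expr2 mulrA.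
by rewrite -[`|w| *+ 2]mulr_natl ler_pM2r.
Qed.

(* A self-adjoint x is x - w = - i t (x w) up to w = x / (1 - i t x), which tends to 0
   when t grows. *)
Lemma cmul_total : total_in [set y | exists a b, y = a *c b].
Proof.
set S := [set y | _]; have [S0 SD cS] := cspan_subspace S.
have sac x : x^c* = x -> cspan S x.
  move=> sx; apply: cS; apply/closureP => e e0.
  pose d : R[i] := (2 * (`|x| + 1))^-1.
  have x1 : 0 < `|x| + 1 :> R[i] by rewrite ltr_wpDl.
  have d0 : 0 < d by rewrite invr_gt0 mulr_gt0.
  have dx : d * `|x| <= 2^-1.
    rewrite /d invfM -mulrA ler_piMr ?invr_ge0 // ler_pdivrMl // mulr1.
    by rewrite lerDl.
  have b0 : 0 < 2 / e / d by rewrite !divr_gt0.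
  pose n := Num.bound (complex.Re (2 / e / d)).
  (* This choice of [n] gives 2 / (d n) < e, which bounds |w| through [resolvent_small]. *)
  have bn : 2 / e / d < n%:R.
    have : complex.Re (2 / e / d) < n%:R.
      by apply: archi_boundP; rewrite -ler0c RRe_real ?gtr0_real // ltW.
    by rewrite -ltcR RRe_real ?gtr0_real // rmorph_nat.
  have [w wP] := resolvent_surj n x sx (ltW d0) dx.
  exists (x - w); last first.
    have n0 : 0 < n%:R :> R[i] by exact: lt_trans bn.
    have t0 : 0 < d *+ n by rewrite -mulr_natr mulr_gt0.
    have := resolvent_small sx (ltW t0) wP.
    rewrite opprB addrC subrK -ler_pdivlMl // => /le_lt_trans; apply.
    by rewrite ltr_pdivrMl //; move: bn; rewrite !ltr_pdivrMr // -[d *+ n]mulr_natl.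
  have -> : x - w = (- ('i * (d *+ n))) *: (x *c w) + 0.
    by rewrite -{1}wP addr0 scaleNr addrC addKr.
  by apply: SD => //; apply: sub_cspan; exists x, w.
apply: total_inP => v.
have -> : v = (2^-1) *: (v + v^c*) + ((2^-1 * - 'i) *: ('i *: (v - v^c*)) + 0).
  rewrite addr0 scalerA -mulrA mulNr -expr2 sqrCi opprK mulr1 -scalerDr.
  rewrite addrACA subrr addr0 -[v + v]mulr2n -[v *+ 2]scaler_nat scalerA.
  by rewrite mulVf ?pnatr_eq0 // scale1r.
apply: (SD); first by apply: sac; rewrite cstarD cstarK addrC.
apply: SD => //; apply: sac.
by rewrite cstarZ cstarB cstarK conjCi scaleNr -scalerN opprB.
Qed.

End Factorization.

(** * Extension of operator-valued maps from a dense family *)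

Section Extension.
Variables (R : realType) (V : normedModType R[i]) (L : Type) (X : L -> V).
Hypothesis Xdense : forall v (e : R[i]), 0 < e -> exists l, `|v - X l| < e.

Lemma norm_vanish (W : normedModType R[i]) (z : W) (C : R[i]) : 0 <= C ->
  (forall e : R[i], 0 < e -> `|z| <= C * e) -> z = 0.
Proof.
move=> C0 zC; apply/eqP; rewrite -normr_le0; apply/ler_addgt0Pr => e e0.
have C1 : 0 < C + 1 by rewrite ltr_wpDl.
apply: (le_trans (zC _ (divr_gt0 e0 C1))); rewrite add0r mulrCA ger_pMr //.
by rewrite ler_pdivrMr // mul1r lerDl.
Qed.

Lemma dense_lim_uniq (W : normedModType R[i]) (g : L -> W) v y y' (K K' : R[i]) :
  0 <= K -> 0 <= K' -> (forall l, `|g l - y| <= K * `|X l - v|) ->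
  (forall l, `|g l - y'| <= K' * `|X l - v|) -> y = y'.
Proof.
move=> K0 K0' gy gy'; apply/eqP; rewrite -subr_eq0; apply/eqP.
apply: (@norm_vanish _ _ (K + K')); first exact: addr_ge0.
move=> e e0; have [l vl] := Xdense v e0; move/ltW: vl; rewrite distrC => vl.
apply: (le_trans (ler_distD (g l) _ _)); rewrite mulrDl; apply: lerD.
  by rewrite distrC; apply: (le_trans (gy l)); exact: ler_wpM2l.
by apply: (le_trans (gy' l)); exact: ler_wpM2l.
Qed.

(** The indices [l] with [X l] close to [v] are sent by [g] into a Cauchy filter. Here [g] is a
    function of the index; the bound makes it depend only on [X l], so well-definedness needs no
    separate argument. *)
Lemma dense_lim (W : completeNormedModType R[i]) (g : L -> W) v (K : R[i]) :
  0 <= K -> (forall l l', `|g l - g l'| <= K * `|X l - X l'|) ->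
  exists y, forall l, `|g l - y| <= K * `|X l - v|.
Proof.
move=> K0 gK.
pose F : set_system W :=
  [set S | exists2 e : R[i], 0 < e & forall l, `|v - X l| < e -> S (g l)].
have FF : ProperFilter F.
  split.
    by case=> e e0 ef; have [l /ef] := Xdense v e0.
  split=> [|S T [e e0 eS] [f f0 fT]|S T ST [e e0 eS]].
  - by exists 1.
  - have efr : (e >=< f)%O by rewrite real_comparable // gtr0_real.
    exists (Num.min e f); first by rewrite comparable_lt_min // e0.
    by move=> l; rewrite comparable_lt_min // => /andP[/eS ? /fT].
  - by exists e => // l /eS/ST.
have K1 : 0 < K + 1 by rewrite ltr_wpDl.
have Fc : cauchy F.
  apply/cauchy_ballP => e e0.
  have d0 : 0 < e / (K + 1) / 2 by rewrite !divr_gt0.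
  pose U := g @` [set l | `|v - X l| < e / (K + 1) / 2].
  have FU : F U by exists (e / (K + 1) / 2) => // l vl; exists l.
  exists (U, U); first by split.
  move=> [_ _] /= [[l /= vl <-] [l' /= vl' <-]]; rewrite -ball_normE /=.
  apply: (le_lt_trans (gK _ _)); have : `|X l - X l'| < e / (K + 1).
    rewrite [e / (K + 1)]splitr; apply: (le_lt_trans (ler_distD v _ _)).
    by apply: ltrD; rewrite // distrC.
  rewrite ltr_pdivlMr // mulrC; apply: le_lt_trans.
  by apply: ler_wpM2r; rewrite ?lerDl.
have Fl : F --> lim F by apply: cauchy_cvg.
exists (lim F) => l; apply/ler_addgt0Pr => e e0.
have d0 : 0 < e / 2 / (K + 1) by rewrite !divr_gt0.
have e20 : 0 < e / 2 by rewrite divr_gt0.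
have Fb : F [set w | `|w - lim F| < e / 2].
  apply: filterS (Fl _ (nbhsx_ballx (lim F) _ e20)) => w.
  by rewrite -ball_normE /= distrC.
have Fd : F (g @` [set l | `|v - X l| < e / 2 / (K + 1)]).
  by exists (e / 2 / (K + 1)) => // l' vl; exists l'.
have [w [/= gl [l' /= vl' wl]]] := filter_ex (filterI Fb Fd); rewrite -wl in gl.
apply: (le_trans (ler_distD (g l') _ _)); rewrite [e]splitr addrA.
apply: lerD; last exact: ltW.
apply: (le_trans (gK _ _)); apply: (@le_trans _ _ (K * (`|X l - v| + `|v - X l'|))).
  by apply: ler_wpM2l => //; exact: ler_distD.
rewrite mulrDr lerD2l; move/ltW: vl'; rewrite ler_pdivlMr // mulrC; apply: le_trans.
by apply: ler_wpM2r; rewrite ?lerDl.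
Qed.

(** A [boundedOp] carries its adjoint, so the operators and their adjoints are extended separately,
    with the same constant; linearity and adjointness pass to the limit. *)
Lemma extend_operators (H : hilbertType R) (O : L -> boundedOp H) (M : R[i]) :
  0 <= M -> (forall l l' h, `|O l h - O l' h| <= M * `|X l - X l'| * `|h|) ->
  exists F : V -> boundedOp H, (forall l, F (X l) = O l) /\
    forall v w h, `|F v h - F w h| <= M * `|v - w| * `|h|.
Proof.
move=> M0 OM.
have OM' l l' h : `|op_adj (O l) h - op_adj (O l') h| <= M * `|X l - X l'| * `|h|.
  apply: inner_bound; first by rewrite !mulr_ge0.
  move=> y; rewrite innerBl !op_adj_swap -innerBr.
  apply: (le_trans (cauchy_schwarz _ _)); rewrite mulrC -[leRHS]mulrA [_ * `|y|]mulrC mulrA.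
  by apply: ler_wpM2r.
have ext (Q : L -> H -> H) : (forall l l' h, `|Q l h - Q l' h| <= M * `|X l - X l'| * `|h|) ->
    exists f : V -> H -> H, forall v h l, `|Q l h - f v h| <= M * `|h| * `|X l - v|.
  move=> QM; have ex (vh : V * H) : exists y, forall l,
      `|Q l vh.2 - y| <= M * `|vh.2| * `|X l - vh.1|.
    apply: dense_lim; first exact: mulr_ge0.
    by move=> l l'; rewrite mulrAC.
  have [f fP] := choice ex.
  by exists (fun v h => f (v, h)) => v h l; exact: (fP (v, h)).
have [f fP] := ext _ OM; have [f' fP'] := ext _ OM'.
have flin v : linear (f v).
  move=> k x y; apply: (@dense_lim_uniq _ (fun l => O l (k *: x + y)) v _ _
      (M * `|k *: x + y|) (`|k| * (M * `|x|) + M * `|y|)).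
  - exact: mulr_ge0.
  - by rewrite addr_ge0 // !mulr_ge0.
  - exact: fP.
  move=> l; rewrite op_linear opprD addrACA -scalerBr mulrDl.
  apply: (le_trans (ler_normD _ _)); apply: lerD; last exact: fP.
  by rewrite normrZ -mulrA; apply: ler_wpM2l.
have fbnd v : exists C : R[i], forall h, `|f v h| <= C * `|h|.
  have [l vl] := Xdense v (@ltr01 R[i]); have [C OC] := op_bounded (O l).
  exists (M + C) => h; rewrite mulrDl -[f v h](subrK (O l h)).
  apply: (le_trans (ler_normD _ _)); apply: lerD => //.
  rewrite distrC; apply: (le_trans (fP _ _ _)); rewrite ler_piMr ?mulr_ge0 //.
  by rewrite distrC ltW.
have fadj v x y : <[f v x, y]> = <[x, f' v y]>.
  apply/eqP; rewrite -subr_eq0; apply/eqP.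
  apply: (@norm_vanish R[i]^o _ (M * `|x| * `|y| + `|x| * (M * `|y|))).
    by rewrite addr_ge0 ?mulr_ge0.
  move=> e e0; have [l /ltW vl] := Xdense v e0.
  have -> : <[f v x, y]> - <[x, f' v y]> =
     <[f v x - O l x, y]> + <[x, op_adj (O l) y - f' v y]>.
    by rewrite innerBl innerBr op_adjP addrA subrK.
  rewrite mulrDl; apply: (le_trans (ler_normD _ _)); apply: lerD.
    apply: (le_trans (cauchy_schwarz _ _)); rewrite [leRHS]mulrAC; apply: ler_wpM2r => //.
    by rewrite distrC; apply: (le_trans (fP _ _ _)); apply: ler_wpM2l;
      rewrite ?mulr_ge0 // distrC.
  apply: (le_trans (cauchy_schwarz _ _)); rewrite -[leRHS]mulrA; apply: ler_wpM2l => //.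
  by apply: (le_trans (fP' _ _ _)); apply: ler_wpM2l; rewrite ?mulr_ge0 // distrC.
exists (fun v => BoundedOp (flin v) (fbnd v) (fadj v)); split=> [l|v w h /=].
  apply: boundedOpP => h /=; apply/esym/eqP; rewrite -subr_eq0 -normr_le0.
  by apply: (le_trans (fP (X l) h l)); rewrite subrr normr0 mulr0.
apply/ler_addgt0Pr => e e0; have C1 : 0 < M * `|h| *+ 2 + 1 :> R[i].
  by rewrite ltr_wpDl // mulrn_wge0 ?mulr_ge0.
have [l /ltW vl] := Xdense v (divr_gt0 e0 C1).
apply: (le_trans (ler_distD (O l h) _ _)); rewrite distrC.
apply: (le_trans (lerD (fP v h l) (fP w h l))).
rewrite [X in _ <= X + _]mulrAC.
apply: (@le_trans _ _ (M * `|h| * `|X l - v| + M * `|h| * (`|X l - v| + `|v - w|))).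
  by rewrite lerD2l; apply: ler_wpM2l; rewrite ?mulr_ge0 //; exact: ler_distD.
rewrite mulrDr addrA [leRHS]addrC lerD2r -mulrDl -mulr2n distrC.
move: vl; rewrite ler_pdivlMr // mulrC; apply: le_trans.
by apply: ler_wpM2r; rewrite ?lerDl.
Qed.

End Extension.

(** * Elements of the tensor product with the translation algebra *)

Section TensorTranslation.
Variables (R : realType) (G : orderedGroup) (A T : cstarType R).
Variables (tens : translationAlg R G -> A -> T) (tensP : cstar_tensor tens).
Local Notation P := (posCone G).
Local Notation B := (translationAlg R G).
Local Notation one_ s := (ta_indic R s).
Implicit Types (s t x : P) (a : A) (b f : B) (l : seq (P * A)).

Lemma tensor_lin_l a : linear (tens^~ a).
Proof. by move=> k b b'; exact: tensor_linearl. Qed.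

Lemma tensor_lin_r b : linear (tens b).
Proof. by move=> k a a'; exact: tensor_linearr. Qed.

Lemma tensor0r b : tens b 0 = 0.
Proof. by apply/eqP; rewrite -normr_eq0 (tensor_norm tensP) normr0 mulr0. Qed.

Lemma tensor0l a : tens 0 a = 0.
Proof. by apply/eqP; rewrite -normr_eq0 (tensor_norm tensP) normr0 mul0r. Qed.

Lemma tensorDr b a a' : tens b (a + a') = tens b a + tens b a'.
Proof. by rewrite -[a in LHS]scale1r tensor_lin_r scale1r. Qed.

Lemma tensorZr b k a : tens b (k *: a) = k *: tens b a.
Proof. by rewrite -[k *: a]addr0 tensor_lin_r tensor0r addr0. Qed.

Lemma tensorDl b b' a : tens (b + b') a = tens b a + tens b' a.
Proof. by rewrite -[b in LHS]scale1r tensor_lin_l scale1r. Qed.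

Lemma tensorZl b k a : tens (k *: b) a = k *: tens b a.
Proof. by rewrite -[k *: b]addr0 tensor_lin_l tensor0l addr0. Qed.

Lemma tensorBl b b' a : tens (b - b') a = tens b a - tens b' a.
Proof. by rewrite tensorDl -scaleN1r tensorZl scaleN1r. Qed.

Lemma tensor_lipschitz_r b : lipschitz_map (tens b).
Proof.
apply: (@linear_lipschitz _ _ _ _ `|b|) => [|a]; first exact: tensor_lin_r.
by rewrite (tensor_norm tensP).
Qed.

Lemma indic_mul s t : one_ s *c one_ t = one_ (pos_max s t).
Proof. by apply: ta_ext => x; exact: indicM. Qed.

(** Elements of the translation algebra are uniform limits of combinations of indicators, and the
    cross norm carries the approximation over to elementary tensors. *)
Lemma tensor_indic_total : total_in [set v | exists s a, v = tens (one_ s) a].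
Proof.
set S := [set v | _]; have SS := cspan_subspace S; have [_ _ cS] := SS.
apply: total_inP; apply: (total_ind (tensor_dense tensP) SS) => _ [b [a ->]].
apply: cS; apply/closureP => e e0.
have a1 : 0 < `|a| + 1 :> R[i] by rewrite ltr_wpDl.
have d0 : 0 < e / (`|a| + 1) by rewrite divr_gt0.
have dR : e / (`|a| + 1) = (complex.Re (e / (`|a| + 1)))%:C%C by rewrite RRe_real ?gtr0_real.
have d0' : 0 < complex.Re (e / (`|a| + 1)) by rewrite -ltcR -dR.
have [n [c [s bs]]] := ta_in b d0'.
pose b' : B := \sum_i c i *: one_ (s i).
have b'E x : b' x = \sum_i c i * indic R (s i) x.
  by rewrite /b'; elim/big_rec2: _ => // i z f _ <-.
exists (tens b' a).
  rewrite /b'; have -> : tens (\sum_i c i *: one_ (s i)) a = \sum_i c i *: tens (one_ (s i)) a.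
    by elim/big_rec2: _ => [|i v f _ <-]; rewrite ?tensor0l // tensorDl tensorZl.
  apply: (closed_subspace_sum _ SS) => i; have [S0 SD _] := SS.
  by rewrite -[_ *: _]addr0; apply: SD => //; apply: sub_cspan; exists (s i), a.
rewrite -tensorBl (tensor_norm tensP).
have nb : `|b - b'| <= e / (`|a| + 1).
  by apply: ta_norm_le => x; rewrite /= mulN1r b'E dR; exact: bs.
apply: (le_lt_trans (ler_wpM2r _ nb)) => //.
by rewrite mulrAC -mulrA gtr_pMr // ltr_pdivrMr // mul1r ltrDl.
Qed.

(** Lists play the role of formal sums, with scalars absorbed into [A]; distinct lists may give the
    same element. *)
Definition tensor_comb l : T := \sum_(p <- l) tens (one_ p.1) p.2.

Lemma tensor_comb_dense (v : T) (e : R[i]) : 0 < e -> exists l, `|v - tensor_comb l| < e.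
Proof.
move=> e0; have : closure (lin_span [set v | exists s a, v = tens (one_ s) a]) v.
  by rewrite tensor_indic_total.
move/closureP => /(_ e e0)[_ [n [c [w [wS ->]]]] vw].
have wS' i : exists p : P * A, w i = tens (one_ p.1) p.2.
  by have [s [a ->]] := wS i; exists (s, a).
have [p pP] := choice wS'.
exists [seq ((p i).1, c i *: (p i).2) | i <- enum 'I_n].
rewrite /tensor_comb big_map big_enum /=.
under eq_bigr do rewrite tensorZr -pP.
exact: vw.
Qed.

(* f is the product of 1_x and of the 1 - 1_t for t in r above x. *)
Lemma indicator_separation (r : seq P) x : exists f : B,
  [/\ f x = 1, forall y, `|f y| <= 1,
      forall t, (pos_val t <= pos_val x) -> f *c one_ t = f
    & forall t, t \in r -> ~~ (pos_val t <= pos_val x) -> f *c one_ t = 0].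
Proof.
elim: r => [|s r [f [fx f1 fle fr]]].
  exists (one_ x); split => [|y|t tx|//].
  - by rewrite /= /indic lexx.
  - by rewrite /= /indic; case: ifP; rewrite ?normr1 ?normr0.
  - rewrite indic_mul /pos_max; case: ifP => // xt; congr ta_indic.
    by apply: val_inj; apply: le_anti; rewrite tx xt.
have [sx|sx] := boolP (pos_val s <= pos_val x).
  exists f; split => // t; rewrite inE => /predU1P[->|]; last exact: fr.
  by rewrite sx.
exists (f - f *c one_ s); split => [|y|t tx|t].
- by rewrite /= /indic (negPf sx) !mulr0 addr0.
- rewrite /= /indic; case: ifP => _; rewrite ?mulr0 ?addr0 //.
  by rewrite mulr1 mulN1r subrr normr0.
- have -> : (f - f *c one_ s) *c one_ t = f *c one_ t - (f *c one_ t) *c one_ s.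
    by apply: ta_ext => y /=; ring.
  by rewrite fle.
- have -> : (f - f *c one_ s) *c one_ t = f *c one_ t - (f *c one_ t) *c one_ s.
    by apply: ta_ext => y /=; ring.
  rewrite inE => /predU1P[-> _|tr tx]; last by rewrite fr // cmul0l subrr.
  rewrite -cmulA indic_mul.
  have -> : pos_max s s = s by rewrite /pos_max; case: ifP.
  by rewrite subrr.
Qed.

(** The value at [x] of the formal sum, seen as an [A]-valued function on the cone. *)
Definition eval_comb x l : A := \sum_(p <- l | pos_val p.1 <= pos_val x) p.2.

(** Multiplying by [tens f c^c*], where [f] separates [x] from the larger indices of [l], leaves [f]
    tensor c^* c, of norm |c|^2; this is at most |c| times the norm of the sum. *)
Lemma eval_comb_le x l : `|eval_comb x l| <= `|tensor_comb l|.
Proof.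
set c := eval_comb x l; have [f [fx f1 fle fr]] := indicator_separation (map fst l) x.
have nf : `|f| = 1.
  apply/eqP; rewrite eq_le; apply/andP; split; first exact: ta_norm_le.
  by rewrite -(normr1 R[i]) -fx; exact: ta_norm_ub.
have [->|c0] := eqVneq c 0; first by rewrite normr0.
have c1 : 0 < `|c| by rewrite normr_gt0.
have e : tens f c^c* *c tensor_comb l = tens f (c^c* *c c).
  have -> : tens f (c^c* *c c) =
      \sum_(p <- l | pos_val p.1 <= pos_val x) tens f (c^c* *c p.2).
    rewrite {2}/c /eval_comb (big_morph (cmul c^c*) (cmulDr _) (cmul0r _)).
    by rewrite (big_morph (tens f) (tensorDr f) (tensor0r f)).
  rewrite /tensor_comb (big_morph (cmul (tens f c^c*)) (cmulDr _) (cmul0r _)).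
  rewrite [RHS]big_mkcond; apply: eq_big_seq => p pl.
  rewrite -(tensor_mul tensP); case: ifP => [/fle ->//|/negbT px].
  by rewrite fr ?tensor0l //; exact: map_f.
rewrite -(ler_pM2l c1) -expr2 -cstar_identity.
have := ler_norm_cmul (tens f c^c*) (tensor_comb l).
by rewrite e !(tensor_norm tensP) nf !mul1r norm_cstar.
Qed.

End TensorTranslation.

(** * Operators attached to formal sums, and their norms *)

Section OperatorSum.
Variables (R : realType) (H : hilbertType R).
Implicit Types S T : boundedOp H.

Definition zero_fun (h : H) : H := 0.

Fact zero_op_linear : linear zero_fun.
Proof. by move=> k x y; rewrite /zero_fun scaler0 addr0. Qed.
Fact zero_op_bounded : exists M : R[i], forall x, `|zero_fun x| <= M * `|x|.
Proof. by exists 0 => x; rewrite mul0r normr0. Qed.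
Fact zero_op_adj x y : <[zero_fun x, y]> = <[x, zero_fun y]>.
Proof. by rewrite /zero_fun inner0l innerC inner0l rmorph0. Qed.
Definition zero_op := BoundedOp zero_op_linear zero_op_bounded zero_op_adj.

Fact add_op_linear S T : linear (fun h => S h + T h).
Proof. by move=> k x y; rewrite !op_linear scalerDr addrACA. Qed.
Fact add_op_bounded S T : exists M : R[i], forall x, `|S x + T x| <= M * `|x|.
Proof.
have [M SM] := op_bounded S; have [N TN] := op_bounded T; exists (M + N) => x.
by rewrite mulrDl; apply: (le_trans (ler_normD _ _)); exact: lerD.
Qed.
Fact add_op_adj S T x y : <[S x + T x, y]> = <[x, op_adj S y + op_adj T y]>.
Proof. by rewrite innerDl innerDr !op_adjP. Qed.
Definition add_op S T := BoundedOp (add_op_linear S T) (add_op_bounded S T) (add_op_adj S T).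

End OperatorSum.

Section OperatorComb.
Variables (R : realType) (G : orderedGroup) (A : cstarType R) (H : hilbertType R).
Variables (pi : A -> boundedOp H) (Q : posCone G -> boundedOp H).
Hypothesis rpi : representation pi.
Hypothesis Qsa : forall s x y, <[Q s x, y]> = <[x, Q s y]>.
Hypothesis Q0 : forall h, Q 0 h = h.
Hypothesis Qmax : forall s t h, Q s (Q t h) = Q (pos_max s t) h.
Hypothesis Qpi : forall s a h, Q s (pi a h) = pi a (Q s h).
Local Notation P := (posCone G).
Implicit Types (s t x : P) (a c : A) (l : seq (P * A)) (h : H).

(** The intended image of the formal sum [l], with 1_s acting as the projection [Q s]. *)
Definition op_comb l : boundedOp H :=
  foldr (fun p S => add_op (comp_op (Q p.1) (pi p.2)) S) (zero_op H) l.

Lemma op_combE l h : op_comb l h = \sum_(p <- l) Q p.1 (pi p.2 h).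
Proof. by elim: l => [|p l IH]; rewrite ?big_nil // big_cons -IH. Qed.

Let lep (p q : P * A) := pos_val p.1 <= pos_val q.1.

Lemma lep_trans : transitive lep.
Proof. by move=> q p r; exact: le_trans. Qed.

Lemma lep_total : total lep.
Proof. by move=> p q; exact: og_total. Qed.

Lemma pythagoras h g : <[h, g]> = 0 -> `|h + g| ^+ 2 = `|h| ^+ 2 + `|g| ^+ 2.
Proof.
move=> hg; rewrite -!inner_norm innerDl !innerDr hg [<[g, h]>]innerC hg rmorph0.
by rewrite addr0 add0r.
Qed.

(* Splits h along Q s1, s1 being the smallest index in l: the operator acts as pi c on
   the kernel part, and the induction hypothesis applies to the range part. *)
Lemma op_comb_sorted_le (C : R[i]) s0 c l h : 0 <= C ->
  path lep (s0, 0) l -> Q s0 h = h ->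
  (forall x, pos_val s0 <= pos_val x -> `|c + eval_comb x l| <= C) ->
  `|pi c h + op_comb l h| <= C * `|h|.
Proof.
(* [c] accumulates the coefficients of the indices already passed. *)
move=> C0; elim: l s0 c h => [|[s1 a1] l IH] s0 c h.
  move=> _ _ /(_ s0 (lexx _)); rewrite /eval_comb big_nil addr0 => cC.
  rewrite op_combE big_nil addr0; apply: (le_trans (rep_le rpi _ _)).
  exact: ler_wpM2r.
rewrite /= => /andP[s01 pl] Qh lC; have {s01} s01 : pos_val s0 <= pos_val s1 by exact: s01.
have l1 : all (lep (s1, 0)) l.
  by apply: (order_path_min lep_trans); case: l pl {IH lC}.
pose h1 := Q s1 h; pose h0 := h - h1.
have Qh1 : Q s1 h1 = h1 by rewrite /h1 Qmax /pos_max; case: ifP.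
have Qh0 s : pos_val s1 <= pos_val s -> Q s h0 = 0.
  move=> s1s; rewrite opB /h1 Qmax /pos_max; case: ifP => [ss1|_]; last by rewrite subrr.
  have -> : s1 = s by apply: val_inj; apply: le_anti; rewrite s1s ss1.
  by rewrite subrr.
pose u := pi c h0; pose w := pi (c + a1) h1 + op_comb l h1.
have uw : pi c h + (Q s1 (pi a1 h) + op_comb l h) = u + w.
  have e : h = h0 + h1 by rewrite subrK.
  have -> : op_comb l h = op_comb l h1.
    rewrite !op_combE; apply: eq_big_seq => p pl1; rewrite {1}e opD opD Qpi Qh0 ?op0 ?add0r //.
    exact: (allP l1).
  rewrite /u /w {1}e opD -addrA; congr (_ + _); rewrite addrA; congr (_ + _).
  by rewrite (repD rpi) Qpi.
have Qu : Q s1 u = 0 by rewrite Qpi Qh0 ?op0.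
have Qw : Q s1 w = w.
  rewrite opD Qpi Qh1; congr (_ + _); rewrite op_combE.
  rewrite (big_morph (Q s1) (opD _) (op0 _)); apply: eq_big_seq => p pl1.
  rewrite Qmax /pos_max; have -> // : pos_val s1 <= pos_val p.1 by exact: (allP l1).
(* [u] lies in the kernel and [w] in the range of [Q s1], so the two parts can be estimated
   separately by Pythagoras. *)
have uw0 : <[u, w]> = 0 by rewrite -Qw -Qsa Qu inner0l.
have h01 : <[h0, h1]> = 0 by rewrite /h1 -Qsa Qh0 // inner0l.
rewrite uw -(@ler_pXn2r _ 2) ?nnegrE ?mulr_ge0 // exprMn.
have -> : `|h| ^+ 2 = `|h0| ^+ 2 + `|h1| ^+ 2 by rewrite -pythagoras // subrK.
rewrite pythagoras // mulrDr -!exprMn; apply: lerD; rewrite ler_pXn2r ?nnegrE ?mulr_ge0 //.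
  (* If s1 = s0 then [h0] vanishes; otherwise no index of the list is below [s0], and the hypothesis
     at [s0] reads |c| <= C. *)
  have [s10|s10] := boolP (pos_val s1 <= pos_val s0).
    have s1E : s1 = s0 by apply: val_inj; apply: le_anti; rewrite s10 s01.
    have h00 : h0 = 0 by rewrite /h0 /h1 s1E Qh subrr.
    by rewrite /u h00 op0 !normr0 mulr0.
  apply: (le_trans (rep_le rpi _ _)); apply: ler_wpM2r => //.
  have := lC s0 (lexx _); rewrite /eval_comb big_cons /= (negPf s10) big_seq_cond.
  rewrite big1 ?addr0 // => p /andP[pl1 ps0]; have := allP l1 p pl1.
  by rewrite /lep /= => /le_trans /(_ ps0) s10'; rewrite s10' in s10.
apply: (IH s1) => //; first by case: l pl {IH lC l1 w uw Qw uw0}.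
move=> x sx; have := lC x (le_trans s01 sx).
by rewrite /eval_comb big_cons /= sx addrA.
Qed.

(** The sum is invariant under sorting [l]; the sorted estimate is started at index 0 with [c = 0],
    where [Q 0] is the identity. *)
Lemma op_comb_le (C : R[i]) l h : (forall x, `|eval_comb x l| <= C) ->
  `|op_comb l h| <= C * `|h|.
Proof.
move=> lC; have C0 : 0 <= C by exact: le_trans (lC 0).
have pl : perm_eq (sort lep l) l by rewrite perm_sort.
have -> : op_comb l h = pi 0 h + op_comb (sort lep l) h.
  by rewrite (rep0 rpi) add0r !op_combE; apply/esym/perm_big.
apply: (@op_comb_sorted_le _ 0) => //; last first.
  by move=> x _; rewrite add0r /eval_comb (perm_big _ pl); exact: lC.
have := sort_sorted lep_total l; case: (sort lep l) => //= p l' ->.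
by rewrite andbT /lep /=; case: p => -[].
Qed.

End OperatorComb.

(** * The isometric representation of a partial-isometric one *)

Lemma pos_le_add (G : orderedGroup) (s t : posCone G) : pos_val s <= pos_val t ->
  exists u, t = u + s.
Proof.
move=> st; exists (PosCone (pos_sub_subproof st)); apply: val_inj => /=.
by rewrite subrK.
Qed.

Section InnerLipschitz.
Variables (R : realType) (H : hilbertType R).

Lemma inner_lipschitz_l (y : H) : lipschitz_map (fun x => <[x, y]> : R[i]^o).
Proof.
apply: (@linear_lipschitz _ _ _ _ `|y|) => [k u v|x]; first exact: innerPl.
by rewrite mulrC; exact: cauchy_schwarz.
Qed.

Lemma inner_lipschitz_r (x : H) : lipschitz_map (fun y => <[x, y]> : R[i]^o).
Proof.
exists `|x| => u v; rewrite -innerBr; exact: cauchy_schwarz.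
Qed.

End InnerLipschitz.

Section PisoRepresentation.
Variables (R : realType) (G : orderedGroup) (A : cstarType R) (alpha : auto_action G A).
Variables (H : hilbertType R) (pi : A -> boundedOp H) (V : posCone G -> boundedOp H).
Hypothesis npi : nondegenerate_rep pi.
Hypothesis piV : covariant_piso alpha pi V.
Local Notation P := (posCone G).
Implicit Types (s t : P) (a : A) (h : H).

Let rpi : representation pi. Proof. by case: npi. Qed.

Lemma piso_add s t h : V (s + t) h = V s (V t h).
Proof. by rewrite -(cpiso_mul piV). Qed.

Lemma piso_adj_add s t h : op_adj (V (s + t)) h = op_adj (V t) (op_adj (V s) h).
Proof. by rewrite -(cpiso_mul piV). Qed.

Lemma piso_act s a h : pi (alpha s a) h = V s (pi a (op_adj (V s) h)).
Proof. by rewrite (cpiso_cov piV). Qed.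

Lemma piso_partial s h : V s (op_adj (V s) (V s h)) = V s h.
Proof. by rewrite -[in RHS](cpiso_partial_isometry piV s). Qed.

Lemma piso_comm s a h : op_adj (V s) (V s (pi a h)) = pi a (op_adj (V s) (V s h)).
Proof. exact: (congr1 (fun S : boundedOp H => S h) (cpiso_comm piV s a)). Qed.

(** By surjectivity of [alpha s], the vectors [pi (alpha s a) k] span a dense subspace; by
    covariance they lie in the range of [V s], where [V s] times its adjoint is the identity. *)
Lemma piso_coisometry s h : V s (op_adj (V s) h) = h.
Proof.
apply: (@total_ind _ _ _ [set h | comp_op (V s) (adj_op (V s)) h = id_op H h] npi.2).
  apply: closed_subspace_equalizer; by [exact: op_linear|exact: op_lipschitz].
move=> _ [b [k ->]] /=.
by rewrite -(auto_invK alpha s b) piso_act piso_partial.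
Qed.

Lemma piso_intertwine s a h : V s (pi a h) = pi (alpha s a) (V s h).
Proof. by rewrite piso_act -piso_comm piso_partial. Qed.

(** [V 0] is idempotent and, as a coisometry, surjective. *)
Lemma piso0 h : V 0 h = h.
Proof.
by rewrite -{1}[h](piso_coisometry 0) -piso_add addr0 piso_coisometry.
Qed.

Definition initial_proj s : boundedOp H := comp_op (adj_op (V s)) (V s).

Lemma initial_proj_sa s x y : <[initial_proj s x, y]> = <[x, initial_proj s y]>.
Proof. by rewrite /= op_adj_swap op_adjP. Qed.

Lemma initial_proj0 h : initial_proj 0 h = h.
Proof. by apply: inner_inj => z; rewrite /= -op_adjP !piso0. Qed.

(** If t = u + s, then V_s V_s^* = 1 absorbs the projection of [s] into V_t^* = V_s^* V_u^*; in the
    opposite order V_t V_t^* V_t = V_t does the same. *)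
Lemma initial_proj_max s t h :
  initial_proj s (initial_proj t h) = initial_proj (pos_max s t) h.
Proof.
rewrite /pos_max; case: ifP => [/pos_le_add[u ->]|st] /=.
  by rewrite piso_adj_add piso_coisometry.
have /pos_le_add[u ->] : pos_val t <= pos_val s.
  by have := og_total (pos_val s) (pos_val t); rewrite st.
by rewrite !piso_add piso_partial.
Qed.

Variables (T : cstarType R) (tens : translationAlg R G -> A -> T).
Hypothesis tensP : cstar_tensor tens.
Variable gamma : endo_action G T.
Hypothesis gammaP : forall (x : posCone G) (b : translationAlg R G) (a : A),
     gamma x (tens b a) = tens (tau R G x b) (auto_inv alpha x a).
Local Notation comb := (tensor_comb tens).
Local Notation opc := (op_comb pi initial_proj).

Definition scale_comb (k : R[i]) (l : seq (P * A)) := [seq (p.1, k *: p.2) | p <- l].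

Lemma tensor_comb_lin k l l' : comb (scale_comb k l ++ l') = k *: comb l + comb l'.
Proof.
rewrite /tensor_comb big_cat big_map scaler_sumr; congr (_ + _).
by apply: eq_bigr => p _; rewrite (tensorZr tensP).
Qed.

Lemma op_comb_lin k l l' h : opc (scale_comb k l ++ l') h = k *: opc l h + opc l' h.
Proof.
rewrite !op_combE big_cat big_map scaler_sumr; congr (_ + _).
by apply: eq_bigr => p _; rewrite (repZ rpi) opZ.
Qed.

(** The values [eval_comb x l] lie between the two norms. Through linearity in [l], the operator
    therefore depends only on the element [comb l]. *)
Lemma op_comb_le_tensor l h : `|opc l h| <= `|comb l| * `|h|.
Proof.
apply: (op_comb_le rpi initial_proj_sa initial_proj0 initial_proj_max).
  by move=> s a g; exact: piso_comm.
by move=> x; exact: eval_comb_le.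
Qed.

Lemma dense_eq (W : normedModType R[i]) (f g : T -> W) :
  lipschitz_map f -> lipschitz_map g -> (forall l, f (comb l) = g (comb l)) -> f =1 g.
Proof.
move=> fl gl fg v; apply: (closed_equalizer fl gl).
by apply/closureP => e /(tensor_comb_dense tensP v)[l vl]; exists (comb l) => //; exact: fg.
Qed.

Lemma tensor_representation : exists rho : T -> boundedOp H,
  [/\ nondegenerate_rep rho,
    forall s a h, rho (tens (ta_indic R s) a) h = initial_proj s (pi a h)
  & covariant_iso gamma rho (fun s => adj_op (V s))].
Proof.
have [||F [Fc Flip]] := @extend_operators R T _ comb (tensor_comb_dense tensP) H opc 1.
- exact: ler01.
- move=> l l' h; have e : comb (scale_comb (-1) l' ++ l) = comb l - comb l'.
    by rewrite tensor_comb_lin scaleN1r addrC.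
  have -> : opc l h - opc l' h = opc (scale_comb (-1) l' ++ l) h.
    by rewrite op_comb_lin scaleN1r addrC.
  by rewrite mul1r -e; exact: op_comb_le_tensor.
have Fl h : lipschitz_map (fun v => F v h).
  by exists `|h| => v w; apply: (le_trans (Flip v w h)); rewrite mul1r mulrC.
(* [total_ind] presupposes linearity, which is therefore checked first on the dense elements
   [comb l], one variable at a time. *)
have Flin (k : R[i]) v w h : F (k *: v + w) h = k *: F v h + F w h.
  have affl (x : R[i]) y : lipschitz_map (fun z : T => x *: z + y).
    exact: (lipschitzD (lipschitzZ x (@lipschitz_map_id _ T)) (lipschitz_map_cst _ y)).
  move: w; apply: dense_eq.
  - apply: (lipschitz_map_comp _ (Fl h)).
    exact: (lipschitzD (lipschitz_map_cst _ (k *: v)) (@lipschitz_map_id _ T)).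
  - exact: (lipschitzD (lipschitz_map_cst _ (k *: F v h)) (Fl h)).
  move=> l; move: v; apply: dense_eq.
  - exact: (lipschitz_map_comp (affl k (comb l)) (Fl h)).
  - exact: (lipschitzD (lipschitzZ k (Fl h)) (lipschitz_map_cst _ (F (comb l) h))).
  by move=> l'; rewrite -tensor_comb_lin !Fc op_comb_lin.
have Fe s a h : F (tens (ta_indic R s) a) h = initial_proj s (pi a h).
  have := congr1 (fun S : boundedOp H => S h) (Fc [:: (s, a)]).
  by rewrite /tensor_comb big_seq1 op_combE big_seq1.
have FM v w : F (v *c w) = (F v * F w)%g.
  apply: boundedOpP => h /=; move: v.
  apply: (total_ind (tensor_indic_total tensP)).
    apply: closed_subspace_equalizer.
    - by move=> k a b; rewrite cmulPl Flin.
    - by move=> k a b; rewrite Flin.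
    - exact: (lipschitz_map_comp (cmul_lipschitz_l w) (Fl h)).
    - exact: Fl.
  move=> _ [s [a ->]] /=; move: w; apply: (total_ind (tensor_indic_total tensP)).
    apply: closed_subspace_equalizer.
    - by move=> k b c; rewrite cmulPr Flin.
    - by move=> k b c; rewrite Flin op_linear.
    - exact: (lipschitz_map_comp (cmul_lipschitz_r _) (Fl h)).
    - exact: (lipschitz_map_comp (Fl h) (op_lipschitz _)).
  move=> _ [t [b ->]]; rewrite /= -(tensor_mul tensP) indic_mul !Fe.
  by rewrite (repM rpi) -initial_proj_max /= -piso_comm.
have FS v : F v^c* = adj_op (F v).
  apply: boundedOpP => y; apply: inner_inj => x /=; rewrite -op_adjP; apply/esym.
  move: v; apply: (total_ind (tensor_indic_total tensP)).
    apply: (@closed_subspace_equalizer _ T R[i]^o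
      (fun v => <[F v x, y]>) (fun v => <[x, F v^c* y]>)).
    - by move=> k a b; rewrite Flin innerPl.
    - by move=> k a b; rewrite cstarP Flin innerDr innerZr conjCK.
    - exact: (lipschitz_map_comp (Fl x) (inner_lipschitz_l y)).
    - apply: lipschitz_map_comp (inner_lipschitz_r x).
      apply: lipschitz_map_comp (Fl y).
      by exists 1 => u v; rewrite -cstarB norm_cstar mul1r.
  move=> _ [s [a ->]] /=; rewrite (tensor_star tensP).
  have -> : (ta_indic R s)^c* = ta_indic R s.
    by apply: ta_ext => z /=; rewrite /indic; case: ifP; rewrite ?rmorph1 ?rmorph0.
  by rewrite !Fe initial_proj_sa (rep_inner rpi) /= piso_comm.
exists F; split => //.
  split; first by split=> // k a b h; exact: Flin.
  (* The tensors 1 (x) a act as [pi a], so nondegeneracy is inherited from [pi]. *)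
  apply: total_inP => h; apply: (total_ind npi.2 (cspan_subspace _)) => _ [a [k ->]].
  apply: sub_cspan; exists (tens (ta_indic R 0) a), k.
  by rewrite Fe initial_proj0.
split=> [s|s t|s v].
- by apply: boundedOpP => h; exact: piso_coisometry.
- by apply: boundedOpP => h /=; rewrite -piso_adj_add addrC.
- apply: boundedOpP => h /=; move: v; apply: (total_ind (tensor_indic_total tensP)).
    have [gl _ _] := act_hom gamma s.
    apply: closed_subspace_equalizer.
    - by move=> k b c; rewrite gl Flin.
    - by move=> k b c; rewrite Flin op_adj_linear.
    - exact: (lipschitz_map_comp (star_hom_lipschitz (act_hom gamma s)) (Fl h)).
    - exact: (lipschitz_map_comp (Fl _) (op_lipschitz (adj_op (V s)))).
  move=> _ [t [a ->]] /=.
  (* Both sides are V_s^* V_t^* V_t applied to equal vectors: the image of 1_(t+s) involves V_(t+s)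
     = V_t V_s, and V_s carries the inverse of [alpha s] at [a] back to [a]. *)
  rewrite gammaP /= tau_indic !Fe /= piso_add piso_adj_add; do 2 congr (op_adj _ _).
  by rewrite piso_intertwine auto_invK.
Qed.

End PisoRepresentation.

(** * The isometric crossed product *)

Section MultiplierTheory.
Variables (R : realType) (B : cstarType R).
Implicit Types (m n v : multiplier B) (a b x : B).

(** The double centralizer identity alone forces module and linearity properties: products separate
    elements, and [m] can be moved to the other factor. *)
Lemma mulL_mul m a b : mulL m (a *c b) = mulL m a *c b.
Proof. by apply: cmul_faithfulr => c; rewrite multiplierE !cmulA multiplierE. Qed.

Lemma mulL_linear m : linear (mulL m).
Proof.
by move=> k a b; apply: cmul_faithfulr => c; rewrite multiplierE !cmulPr !multiplierE.
Qed.

Lemma mulR_linear m : linear (mulR m).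
Proof.
by move=> k a b; apply: cmul_faithfull => c; rewrite -multiplierE !cmulPl -!multiplierE.
Qed.

Lemma multiplier_extL m n : mulL m =1 mulL n -> m = n.
Proof.
move=> mn; apply: multiplier_ext; apply/funext => a //.
by apply: cmul_faithfull => c; rewrite -!multiplierE mn.
Qed.

Lemma mulL_mulR m n x : mulL m (mulR n x) = mulR n (mulL m x).
Proof.
by apply: cmul_faithfull => c; rewrite -mulL_mul -!multiplierE mulL_mul.
Qed.

Lemma mulL_adjE m x y : (mulL m x)^c* *c y = x^c* *c mulL m^adj y.
Proof. by rewrite multiplierE /= cstarK. Qed.

Lemma isometry_mulLK v x : isometry v -> mulL v^adj (mulL v x) = x.
Proof. exact: (congr1 (fun m => mulL m x)). Qed.

Lemma isometry_norm v x : isometry v -> `|mulL v x| = `|x|.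
Proof.
move=> iv; apply: sqr_norm_inj => //.
by rewrite -!cstar_identity mulL_adjE isometry_mulLK.
Qed.

(** With y = v^* x one has |y|^2 = |(v y)^* x| <= |y| |x|. *)
Lemma isometry_adj_norm v x : isometry v -> `|mulL v^adj x| <= `|x|.
Proof.
move=> iv; set y := mulL _ x; have [->|y0] := eqVneq y 0; first by rewrite normr0.
have y1 : 0 < `|y| by rewrite normr_gt0.
rewrite -(ler_pM2l y1) -expr2 -cstar_identity -mulL_adjE.
by apply: (le_trans (ler_norm_cmul _ _)); rewrite norm_cstar isometry_norm.
Qed.

Lemma isometry_lipschitz v : isometry v -> lipschitz_map (mulL v).
Proof.
move=> iv; apply: (@linear_lipschitz _ _ _ _ 1) => [|x]; first exact: mulL_linear.
by rewrite mul1r isometry_norm.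
Qed.

Lemma isometry_adj_lipschitz v : isometry v -> lipschitz_map (mulL v^adj).
Proof.
move=> iv; apply: (@linear_lipschitz _ _ _ _ 1) => [|x]; first exact: mulL_linear.
by rewrite mul1r isometry_adj_norm.
Qed.

Lemma isometry_mulR_lipschitz v : isometry v -> lipschitz_map (mulR v).
Proof.
move=> iv; apply: (@linear_lipschitz _ _ _ _ 1) => [|x]; first exact: mulR_linear.
rewrite mul1r -norm_cstar -[leRHS]norm_cstar -[x in leLHS]cstarK.
exact: (isometry_adj_norm x^c* iv).
Qed.

End MultiplierTheory.

(** * The partial-isometric structure of the isometric crossed product *)

Section CrossedProduct.
Variables (R : realType) (G : orderedGroup) (A : cstarType R) (alpha : auto_action G A).
Variables (T : cstarType R) (tens : translationAlg R G -> A -> T).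
Hypothesis tensP : cstar_tensor tens.
Variable gamma : endo_action G T.
Hypothesis gammaP : forall (x : posCone G) (b : translationAlg R G) (a : A),
  gamma x (tens b a) = tens (tau R G x b) (auto_inv alpha x a).
Variables (D : cstarType R) (j : T -> D) (v : posCone G -> multiplier D).
Hypothesis jP : isometric_crossed_product gamma j v.
Local Notation P := (posCone G).
Local Notation i a := (j (tens (ta_one R G) a)).
Implicit Types (s t r u : P) (a : A) (c : T) (d x y : D).

Let hj : star_hom j. Proof. by case: jP => -[]. Qed.
Let iso s : isometry (v s). Proof. by case: (icp_covariant jP) => + _ _; apply. Qed.

Lemma jM c c' : j (c *c c') = j c *c j c'. Proof. by case: hj => _ + _; apply. Qed.

Lemma vK s d : mulL (v s)^adj (mulL (v s) d) = d.
Proof. exact: isometry_mulLK. Qed.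

Lemma vD s t d : mulL (v (s + t)) d = mulL (v s) (mulL (v t) d).
Proof. by rewrite -(ciso_mul (icp_covariant jP)). Qed.

Lemma v_adjD s t d : mulL (v (s + t))^adj d = mulL (v t)^adj (mulL (v s)^adj d).
Proof. by rewrite -(ciso_mul (icp_covariant jP)) /= !cstarK. Qed.

Lemma v0 d : mulL (v 0) d = d.
Proof. by rewrite -[LHS](vK 0) -vD addr0 vK. Qed.

Lemma j_act s c d : j (gamma s c) *c d = mulL (v s) (j c *c mulL (v s)^adj d).
Proof.
exact: (congr1 (fun m => mulL m d) (ciso_cov (icp_covariant jP) s c)).
Qed.

Lemma j_indic s a : tens (ta_indic R s) a = gamma s (tens (ta_one R G) (alpha s a)).
Proof. by rewrite gammaP auto_actK /= tau_indic add0r. Qed.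

Lemma v_intertwine s c d : mulL (v s) (j c *c d) = j (gamma s c) *c mulL (v s) d.
Proof. by rewrite j_act vK. Qed.

(* The projection v_s v_s^* is the image of 1_s (x) 1: it fixes j (1_s (x) a) because
   1_s (x) a is in the range of gamma_s, and it kills j ((1 - 1_s) (x) a). *)
Lemma one_sub_indic_v s a d : j (tens (ta_one R G - ta_indic R s) a) *c mulL (v s) d = 0.
Proof.
set b1 := _ - _; have jl := hom_linear hj; have jlip := star_hom_lipschitz hj.
move: d; apply: (total_ind (icp_nondegenerate jP).2).
  apply: closed_subspace_equalizer.
  - by move=> k x y; rewrite mulL_linear cmulPr.
  - by move=> k x y; rewrite scaler0 addr0.
  - exact: (lipschitz_map_comp (isometry_lipschitz (iso s)) (cmul_lipschitz_r _)).
  - exact: lipschitz_map_cst.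
(* Moving [v s] past [j c] turns [c] into [gamma s c], so a product in [T] remains to be shown
   zero. *)
move=> _ [c [d ->]] /=; rewrite v_intertwine cmulA -jM.
suff -> : tens b1 a *c gamma s c = 0 by rewrite (star_hom0 hj) cmul0l.
move: c; apply: (total_ind (tensor_dense tensP)).
  apply: closed_subspace_equalizer.
  - by move=> k x y; rewrite (hom_linear (act_hom gamma s)) cmulPr.
  - by move=> k x y; rewrite scaler0 addr0.
  - exact: (lipschitz_map_comp (star_hom_lipschitz (act_hom gamma s)) (cmul_lipschitz_r _)).
  - exact: lipschitz_map_cst.
move=> _ [b [a' ->]] /=; rewrite gammaP -(tensor_mul tensP).
(* Disjoint supports: [b1] vanishes from [s] on, and a translate by [s] vanishes elsewhere. *)
have -> : b1 *c tau R G s b = 0; last exact: tensor0l.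
apply: ta_ext => x /=; rewrite /translate; case: pselect => sx; last by rewrite mulr0.
have x0 : 0 <= pos_val x by case: x {sx}.
by rewrite /indic /= sx x0 mulr1 subrr mul0r.
Qed.

(** Split 1 into 1 - 1_s and 1_s: the first part kills the range of [v s], and on the second the
    covariance of [j] applies. *)
Lemma i_v s a d : i a *c mulL (v s) d = mulL (v s) (i (alpha s a) *c d).
Proof.
have -> : i a = j (tens (ta_one R G - ta_indic R s) a) + j (tens (ta_indic R s) a).
  rewrite -[X in X + _]scale1r -(hom_linear hj) scale1r -(tensorDl tensP).
  by rewrite subrK.
by rewrite cmulDl one_sub_indic_v add0r j_indic j_act vK.
Qed.

Lemma i_star a : (i a)^c* = i a^c*.
Proof.
rewrite -(hom_star hj) (tensor_star tensP); congr (j (tens _ _)).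
by apply: ta_ext => x /=; rewrite /indic; case: ifP; rewrite ?rmorph1 ?rmorph0.
Qed.

Lemma v_adj_i s a d : mulL (v s)^adj (i a *c d) = i (alpha s a) *c mulL (v s)^adj d.
Proof.
apply: cmul_faithfulr => y; rewrite -[y]cstarK -mulL_adjE !cmulA.
have -> : (mulL (v s) y^c*)^c* *c i a = (i a^c* *c mulL (v s) y^c*)^c*.
  by rewrite cstarM i_star cstarK.
by rewrite i_v mulL_adjE cstarM i_star -(hom_star (act_hom alpha s)) !cstarK.
Qed.

Lemma i_hom : star_hom (fun a => i a).
Proof.
split=> [k a b|a b|a].
- by rewrite (tensor_lin_r tensP) (hom_linear hj).
- by rewrite -jM -(tensor_mul tensP) indic_mul /pos_max; case: ifP.
- by rewrite i_star.
Qed.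

Lemma i_nondegenerate : nondegenerate_hom (fun a => i a).
Proof.
split; first exact: i_hom.
set S := [set b | _]; have SS := cspan_subspace S; apply: total_inP.
apply: (total_ind (icp_nondegenerate jP).2 SS) => _ [c [d ->]].
have jd : linear (fun c => j c *c d) by move=> k x y; rewrite (hom_linear hj) cmulPl.
have jdl := lipschitz_map_comp (star_hom_lipschitz hj) (cmul_lipschitz_l d).
move: c; apply: (total_ind (tensor_indic_total tensP)).
  exact: (closed_subspace_preimage jd jdl SS).
(* Factoring 1_r (x) ab = (1 (x) a)(1_r (x) b) requires the products ab to be total in [A]. *)
move=> _ [r [a ->]]; move: a; apply: (total_ind (@cmul_total R A)).
  apply: (closed_subspace_preimage (f := fun a => j (tens (ta_indic R r) a) *c d)) => //.
    by move=> k x y; rewrite (tensor_lin_r tensP) (hom_linear hj) cmulPl.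
  exact: (lipschitz_map_comp (tensor_lipschitz_r tensP _) jdl).
move=> _ [a [b ->]]; apply: sub_cspan; exists a, (j (tens (ta_indic R r) b) *c d).
rewrite cmulA -jM -(tensor_mul tensP) indic_mul.
by rewrite /pos_max; have -> : pos_val (0 : P) <= pos_val r by case: r.
Qed.

Lemma i_covariant :
  covariant_piso alpha (@mult_of R D \o (fun a => i a)) (fun s => (v s)^adj).
Proof.
have vv s : ((v s)^-1 * v s = 1)%g by exact: iso.
split=> [s|s t|s a|s a]; rewrite /partial_isometry ?invgK.
- by rewrite vv mul1g.
- by rewrite -invgM (ciso_mul (icp_covariant jP)) addrC.
- by apply: multiplier_extL => d /=; rewrite i_v; apply/esym/vK.
- apply: multiplier_extL => d.
  transitivity (mulL (v s) (mulL (v s)^adj (i a *c d))) => //; by rewrite v_adj_i -i_v.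
Qed.

Lemma i_universal (H : hilbertType R) (pi : A -> boundedOp H) (V : P -> boundedOp H) :
  nondegenerate_rep pi -> covariant_piso alpha pi V ->
  exists rho : D -> boundedOp H, [/\ nondegenerate_rep rho,
    forall a, rho (i a) = pi a & forall s, extends_to rho (v s)^adj (V s)].
Proof.
move=> npi piV; have [rT [nT rTe cT]] := tensor_representation npi piV tensP gammaP.
have [rho [[nrho rhoj rhov] _]] := icp_universal jP nT cT.
have rrho := nrho.1; exists rho; split=> // [a|s d h].
  by rewrite rhoj; apply: boundedOpP => h; rewrite rTe (initial_proj0 npi piV).
(* [rho] sends [v s] to the adjoint of [V s]; the statement for adjoints is read off by pairing with
   the total vectors [rho d' k]. *)
apply: inner_inj => z; move: z; apply: (total_ind nrho.2).
  apply: (@closed_subspace_equalizer _ H R[i]^o (fun z => <[z, V s (rho d h)]>)).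
  - by move=> k x y; rewrite innerPl.
  - by move=> k x y; rewrite innerPl.
  - exact: inner_lipschitz_l.
  - exact: inner_lipschitz_l.
move=> _ [d' [k ->]] /=.
rewrite -op_adj_swap (rhov s d' k : op_adj (V s) _ = _) !(rep_inner rrho) -!(repM rrho).
by rewrite mulL_adjE.
Qed.

(** Writing j(1_r (x) a) as v_r i(alpha_r a) v_r^*, a generator v_s^* j(1_r (x) a) v_t contains
    v_s^* v_r and v_r^* v_t. By total order each collapses to a single isometry or adjoint, which is
    then moved past [i] to reach the form v_p i(b) v_q^*. *)
Lemma i_span : total_in (crossed_span (fun a => i a) (fun s => (v s)^adj)).
Proof.
set S := crossed_span _ _; have SS := cspan_subspace S.
have RA0 x : mulR (v 0)^adj x = x by rewrite /= v0 cstarK.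
have RAD s t x : mulR (v s)^adj (mulR (v t)^adj x) = mulR (v (s + t))^adj x.
  by rewrite /= cstarK vD.
have RRD s t x : mulR (v (s + t)) x = mulR (v t) (mulR (v s) x).
  by rewrite -(ciso_mul (icp_covariant jP)).
have RRA s x : mulR (v s) (mulR (v s)^adj x) = x.
  exact: (congr1 (fun m => mulR m x) (iso s)).
have RRi s a : mulR (v s) (i a) = mulL (v s) (i (alpha s a)).
  by apply: cmul_faithfull => d; rewrite -multiplierE i_v mulL_mul.
have Mi s a : mulL (v s)^adj (i a) = mulR (v s)^adj (i (alpha s a)).
  by apply: cmul_faithfull => d; rewrite -mulL_mul v_adj_i multiplierE.
have jr r a : j (tens (ta_indic R r) a) = mulR (v r)^adj (mulL (v r) (i (alpha r a))).
  apply: cmul_faithfull => d; rewrite j_indic j_act -multiplierE.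
  by rewrite mulL_mul.
have inS s a t : S (mulR (v t)^adj (mulL (v s) (i a))).
  by exists s, a, t; rewrite invgK.
have leP s t : (exists u, t = u + s) \/ (exists u, s = u + t).
  by have /orP[/pos_le_add|/pos_le_add] := og_total (pos_val s) (pos_val t); [left|right].
have ML s r a : (exists u, mulL (v s)^adj (mulL (v r) (i a)) = mulL (v u) (i a)) \/
    (exists u b, mulL (v s)^adj (mulL (v r) (i a)) = mulR (v u)^adj (i b)).
  have [[u ->]|[u ->]] := leP s r.
    by left; exists u; rewrite addrC vD vK.
  by right; exists u, (alpha u a); rewrite addrC v_adjD vK Mi.
have RRRA t r x : (exists u, mulR (v t) (mulR (v r)^adj x) = mulR (v u)^adj x) \/
    (exists u, mulR (v t) (mulR (v r)^adj x) = mulR (v u) x).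
  have [[u ->]|[u ->]] := leP t r.
    by left; exists u; rewrite [u + t]addrC -RAD RRA.
  by right; exists u; rewrite [u + r]addrC RRD RRA.
have key s r a t : S (mulR (v t) (mulL (v s)^adj (j (tens (ta_indic R r) a)))).
  rewrite jr mulL_mulR.
  have [[u ->]|[u [b ->]]] := ML s r (alpha r a).
    have [[w ->]|[w ->]] := RRRA t r (mulL (v u) (i (alpha r a))); first exact: inS.
    (* A missing factor is supplied by [v 0], which acts as the identity. *)
    by rewrite -mulL_mulR RRi -vD -[X in S X]RA0.
  have [[w ->]|[w ->]] := RRRA t r (mulR (v u)^adj (i b)); first by rewrite RAD -[i b]v0.
  (* Here adjoint and isometry meet once more on the right of [i b], and collapse a second time. *)
  have [[z ->]|[z ->]] := RRRA w u (i b); first by rewrite -[i b]v0.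
  by rewrite RRi -[X in S X]RA0.
apply: total_inP; apply: (total_ind (icp_span jP) SS) => _ [s [c [t ->]]].
move: c; apply: (total_ind (tensor_indic_total tensP)).
  apply: (closed_subspace_preimage (f := fun c => mulR (v t) (mulL (v s)^adj (j c)))) => //.
    by move=> k x y; rewrite (hom_linear hj) mulL_linear mulR_linear.
  exact: (lipschitz_map_comp (star_hom_lipschitz hj) (lipschitz_map_comp
    (isometry_adj_lipschitz (iso s)) (isometry_mulR_lipschitz (iso t)))).
by move=> _ [r [a ->]]; apply: sub_cspan; exact: key.
Qed.

End CrossedProduct.

Theorem proposition5p1 (R : realType) (G : orderedGroup) (A : cstarType R)
  (alpha : auto_action G A)
  (T : cstarType R) (tens : translationAlg R G -> A -> T)
  (tensP : cstar_tensor tens)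
  (gamma : endo_action G T)
  (gammaP : forall (x : posCone G) (b : translationAlg R G) (a : A),
     gamma x (tens b a) = tens (tau R G x b) (auto_inv alpha x a))
  (D : cstarType R) (j : T -> D) (j_G : posCone G -> multiplier D)
  (jP : isometric_crossed_product gamma j j_G) :
  partial_isometric_crossed_product alpha
    (fun a : A => j (tens (ta_one R G) a))
    (fun x : posCone G => (j_G x)^adj).
Proof.
split.
- exact: (i_nondegenerate tensP jP).
- exact: (i_covariant tensP gammaP jP).
- exact: (i_universal tensP gammaP jP).
- exact: (i_span tensP gammaP jP).
Qed.
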